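(* Let $U$ and $V$ be vertex operator algebras, and assume that $U$ and $V$ are $\mathbb{N}$-graded by conformal weights. If the categories $\mathcal{C}_U^1$ and $\mathcal{C}_V^1$ of $C_1$-cofinite grading-restricted generalized $U$- and $V$-modules are closed under submodules, and if all objects in $\mathcal{C}_U^1$ and $\mathcal{C}_V^1$ have finite length, then $\mathcal{D}(\mathcal{C}_U^1,\mathcal{C}_V^1)=\mathcal{C}_{U\otimes V}^1$.
   Context: Everything is over $\mathbb{C}$, $\mathbb{N}=\{0,1,2,\ldots\}$. A vertex operator algebra (VOA) is $V=\bigoplus_{n\in\mathbb{Z}}V_{(n)}$ with $\dim V_{(n)}<\infty$ and $V_{(n)}=0$ for $n\ll 0$, vertex operators $Y_V(v,x)=\sum_{n\in\mathbb{Z}}v_n\,x^{-n-1}$, vacuum $\mathbf{1}$ and conformal vector $\omega$ with $Y_V(\omega,x)=\sum_n L(n)x^{-n-2}$, where $V_{(n)}$ is the $L(0)$-eigenspace of eigenvalue (conformal weight) $n$; it is $\mathbb{N}$-graded if $V_{(n)}=0$ for $n<0$. A weak $V$-module is a module for $V$ viewed as a vertex algebra, with no grading assumed. A generalized $V$-module is a weak $V$-module that is the direct sum of its generalized $L(0)$-eigenspaces $W_{[h]}$, $h\in\mathbb{C}$; it is grading-restricted if for every $h$, $\dim W_{[h]}<\infty$ and $W_{[h+n]}=0$ for all sufficiently negative $n\in\mathbb{Z}$. Categories of modules are full subcategories closed under isomorphisms. $U\otimes V$ is a VOA with $Y_{U\otimes V}(u\otimes v,x)=Y_U(u,x)\otimes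 Y_V(v,x)$, vacuum $\mathbf{1}_U\otimes\mathbf{1}_V$ and conformal vector $\omega_U\otimes\mathbf{1}_V+\mathbf{1}_U\otimes\omega_V$. A $U\otimes V$-module restricts to a weak $U$-module and a weak $V$-module via $u\mapsto u\otimes\mathbf{1}_V$ and $v\mapsto\mathbf{1}_U\otimes v$. A grading-restricted generalized $V$-module $W$ is $C_1$-cofinite if $\dim W/C_1(W)<\infty$, where $C_1(W)=\mathrm{span}\{v_{-1}w\mid w\in W,\ v\in V\text{ homogeneous},\ \mathrm{wt}\,v>0\}$; $\mathcal{C}_V^1$ denotes the category of such modules (and similarly for $U$ and $U\otimes V$). For additive categories $\mathcal{U}$ and $\mathcal{V}$ of grading-restricted generalized $U$- and $V$-modules, $\mathcal{D}(\mathcal{U},\mathcal{V})$ is the category of finite-length grading-restricted generalized $U\otimes V$-modules $X$ such that the $U$-submodule generated by any vector in $X$ is an object of $\mathcal{U}$, and the $V$-submodule generated by any vector in $X$ is an object of $\mathcal{V}$. *)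

(* Defs.v *)
From HB Require Import structures.
From mathcomp Require Import all_boot all_order all_algebra.
From mathcomp Require Import boolp classical_sets functions cardinality fsbigop.
From mathcomp Require Import reals zify.
From mathcomp.real_closed Require Import complex.
Set Implicit Arguments.
Unset Strict Implicit.
Unset Printing Implicit Defensive.
Import Order.TTheory GRing.Theory Num.Theory.
Local Open Scope classical_set_scope.
Local Open Scope ring_scope.

Section LinearAlgebra.
Variables (K : fieldType) (W : lmodType K).
Implicit Types (A : set W).

Definition span A : set W :=
  [set w | exists (n : nat) (a : 'I_n -> K) (x : 'I_n -> W),
     (forall i, A (x i)) /\ w = \sum_(i < n) a i *: x i].

Definition finite_dimensional A : Prop :=
  exists (n : nat) (e : 'I_n -> W), (forall i, A (e i)) /\
    forall w, A w -> exists a : 'I_n -> K, w = \sum_(i < n) a i *: e i.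

(* [dim (W / A) < oo], for a subspace [A]: the cosets of the [e i] span. *)
Definition finite_codimensional A : Prop :=
  exists (n : nat) (e : 'I_n -> W),
    forall w, exists a : 'I_n -> K, A (w - \sum_(i < n) a i *: e i).

Definition direct_sum (I : choiceType) (E : I -> set W) : Prop :=
  (forall w, exists (s : seq I) (f : I -> W),
     [/\ uniq s, forall i, E i (f i) & w = \sum_(i <- s) f i]) /\
  (forall (s : seq I) (f : I -> W), uniq s -> (forall i, E i (f i)) ->
     \sum_(i <- s) f i = 0 -> forall i, i \in s -> f i = 0).

End LinearAlgebra.

Section BilinearMaps.
Variables (K : fieldType) (A B W : lmodType K).

Definition bilinear_map (f : A -> B -> W) : Prop :=
  (forall a x x' y, f (a *: x + x') y = a *: f x y + f x' y) /\
  (forall a x y y', f x (a *: y + y') = a *: f x y + f x y').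

Lemma bilinear_map0l f y : bilinear_map f -> f 0 y = 0.
Proof.
move=> [fl _]; have := fl 1 0 0 y.
by rewrite scale1r addr0 scale1r -{1}[f 0 y]addr0 => /addrI/esym.
Qed.

Lemma bilinear_map0r f x : bilinear_map f -> f x 0 = 0.
Proof.
move=> [_ fr]; have := fr 1 x 0 0.
by rewrite scale1r addr0 scale1r -{1}[f x 0]addr0 => /addrI/esym.
Qed.

Lemma bilinear_mapDl f x x' y : bilinear_map f ->
  f (x + x') y = f x y + f x' y.
Proof. by move=> [fl _]; rewrite -[x in LHS]scale1r fl scale1r. Qed.

Lemma bilinear_mapDr f x y y' : bilinear_map f ->
  f x (y + y') = f x y + f x y'.
Proof. by move=> [_ fr]; rewrite -[y in LHS]scale1r fr scale1r. Qed.

Lemma bilinear_mapZl f a x y : bilinear_map f -> f (a *: x) y = a *: f x y.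
Proof.
move=> bf; have [fl _] := bf.
by rewrite -[a *: x in LHS]addr0 fl (bilinear_map0l _ bf) addr0.
Qed.

Lemma bilinear_mapZr f a x y : bilinear_map f -> f x (a *: y) = a *: f x y.
Proof.
move=> bf; have [_ fr] := bf.
by rewrite -[a *: y in LHS]addr0 fr (bilinear_map0r _ bf) addr0.
Qed.

End BilinearMaps.

(* The tensor product of two arbitrary vector spaces.  The list
   [:: (x1, y1); ..; (xn, yn)] stands for the sum of the xi (x) yi, and
   [tensor_rel] is the congruence generated by commutativity and
   bilinearity. *)
Section TensorProduct.
Variables (K : fieldType) (A B : lmodType K).
Implicit Types (s t : seq (A * B)).

Inductive tensor_rel : seq (A * B) -> seq (A * B) -> Prop :=
| TRrefl s : tensor_rel s s
| TRsym s t : tensor_rel s t -> tensor_rel t s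
| TRtrans s t r : tensor_rel s t -> tensor_rel t r -> tensor_rel s r
| TRcat s s' t t' :
    tensor_rel s s' -> tensor_rel t t' -> tensor_rel (s ++ t) (s' ++ t')
| TRcatC s t : tensor_rel (s ++ t) (t ++ s)
| TR0 y : tensor_rel [:: (0, y)] [::]
| TRDl x x' y : tensor_rel [:: (x + x', y)] [:: (x, y); (x', y)]
| TRDr x y y' : tensor_rel [:: (x, y + y')] [:: (x, y); (x, y')]
| TRZ a x y : tensor_rel [:: (a *: x, y)] [:: (x, a *: y)].

Definition tensor_relb s t : bool := `[< tensor_rel s t >].

Lemma tensor_relb_refl : reflexive tensor_relb.
Proof. by move=> s; apply/asboolP/TRrefl. Qed.

Lemma tensor_relb_sym : symmetric tensor_relb.
Proof. by move=> s t; apply/asboolP/asboolP; exact: TRsym. Qed.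

Lemma tensor_relb_trans : transitive tensor_relb.
Proof.
by move=> t s r /asboolP st /asboolP tr; apply/asboolP; exact: TRtrans st tr.
Qed.

Canonical tensor_equiv :=
  EquivRel tensor_relb tensor_relb_refl tensor_relb_sym tensor_relb_trans.

Definition tensor : Type := {eq_quot tensor_equiv}%qT.
HB.instance Definition _ : EqQuotient _ tensor_relb tensor :=
  EqQuotient.on tensor.
HB.instance Definition _ := Choice.on tensor.

Local Notation cls := (fun s => (\pi_tensor s)%qT : tensor).

Lemma tensor_eqP s t : tensor_rel s t <-> cls s = cls t.
Proof.
split=> [st|/eqquotP /asboolP //]; first by apply/eqquotP/asboolP.
Qed.

Lemma tensor_reprP s : tensor_rel (repr (cls s)) s.
Proof. by apply/tensor_eqP; rewrite reprK. Qed.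

Definition tensor_add (p q : tensor) : tensor := cls (repr p ++ repr q).

Definition tensor_scale (a : K) (p : tensor) : tensor :=
  cls [seq (a *: z.1, z.2) | z <- repr p].

Lemma tensor_addE s t : tensor_add (cls s) (cls t) = cls (s ++ t).
Proof. by apply/tensor_eqP/TRcat; exact: tensor_reprP. Qed.

Lemma tensor_rel_scale a s t : tensor_rel s t ->
  tensor_rel [seq (a *: z.1, z.2) | z <- s] [seq (a *: z.1, z.2) | z <- t].
Proof.
elim=> {s t} /=.
- by move=> s; exact: TRrefl.
- by move=> s t _; exact: TRsym.
- by move=> s t r _ st _ tr; exact: TRtrans st tr.
- by move=> s s' t t' _ ss _ tt; rewrite !map_cat; exact: TRcat.
- by move=> s t; rewrite !map_cat; exact: TRcatC.
- by move=> y; rewrite scaler0; exact: TR0.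
- by move=> x x' y; rewrite scalerDr; exact: TRDl.
- by move=> x y y'; exact: TRDr.
- by move=> b x y; rewrite scalerA mulrC -scalerA; exact: TRZ.
Qed.

Lemma tensor_scaleE a s :
  tensor_scale a (cls s) = cls [seq (a *: z.1, z.2) | z <- s].
Proof. by apply/tensor_eqP/tensor_rel_scale; exact: tensor_reprP. Qed.

Lemma tensor_ind (P : tensor -> Prop) : (forall s, P (cls s)) -> forall p, P p.
Proof. by move=> Ps p; rewrite -[p]reprK; exact: Ps. Qed.

Lemma tensor_addA : associative tensor_add.
Proof.
elim/tensor_ind=> s; elim/tensor_ind=> t; elim/tensor_ind=> r.
by rewrite !tensor_addE catA.
Qed.

Lemma tensor_addC : commutative tensor_add.
Proof.
elim/tensor_ind=> s; elim/tensor_ind=> t.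
by rewrite !tensor_addE; apply/tensor_eqP/TRcatC.
Qed.

Lemma tensor_add0 : left_id (cls [::]) tensor_add.
Proof. by elim/tensor_ind=> s; rewrite tensor_addE. Qed.

Lemma tensor_scaleDl p a b :
  tensor_scale (a + b) p = tensor_add (tensor_scale a p) (tensor_scale b p).
Proof.
elim/tensor_ind: p => s; rewrite !tensor_scaleE tensor_addE.
apply/tensor_eqP; elim: s => [|[x y] s IH] /=; first exact: TRrefl.
rewrite scalerDl; set p := (a *: x, y); set q := (b *: x, y).
apply: TRtrans (TRcat (TRDl _ _ _) IH) _.
set sa := [seq _ | _ <- s]; set sb := [seq _ | _ <- s].
rewrite -cat_rcons -cats1.
exact: (TRcat (TRrefl [:: p]) (TRcat (TRcatC [:: q] sa) (TRrefl sb))).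
Qed.

Lemma tensor_scale0 p : tensor_scale 0 p = cls [::].
Proof.
elim/tensor_ind: p => s; rewrite tensor_scaleE.
apply/tensor_eqP; elim: s => [|[x y] s IH] /=; first exact: TRrefl.
by rewrite scale0r -cat1s; apply: (TRcat (TR0 _) IH).
Qed.

Lemma tensor_scale1 : left_id 1 tensor_scale.
Proof.
elim/tensor_ind=> s; rewrite tensor_scaleE; congr (\pi_tensor _)%qT.
by elim: s => //= -[x y] s -> /=; rewrite scale1r.
Qed.

Definition tensor_opp (p : tensor) : tensor := tensor_scale (-1) p.

Lemma tensor_addN : left_inverse (cls [::]) tensor_opp tensor_add.
Proof.
move=> p; rewrite -[X in tensor_add _ X]tensor_scale1 -tensor_scaleDl.
by rewrite addNr tensor_scale0.
Qed.

HB.instance Definition _ :=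
  GRing.isZmodule.Build tensor tensor_addA tensor_addC tensor_add0 tensor_addN.

Lemma tensor_scaleA a b p :
  tensor_scale a (tensor_scale b p) = tensor_scale (a * b) p.
Proof.
elim/tensor_ind: p => s; rewrite !tensor_scaleE -map_comp.
by congr (\pi_tensor _)%qT; apply: eq_map => z /=; rewrite scalerA.
Qed.

Lemma tensor_scaleDr : right_distributive tensor_scale tensor_add.
Proof.
move=> a; elim/tensor_ind=> s; elim/tensor_ind=> t.
by rewrite tensor_addE !tensor_scaleE tensor_addE map_cat.
Qed.

HB.instance Definition _ := GRing.Zmodule_isLmodule.Build K tensor
  tensor_scaleA tensor_scale1 tensor_scaleDr tensor_scaleDl.

Definition tens (x : A) (y : B) : tensor := (\pi_tensor [:: (x, y)])%qT.

Lemma tensor_addrE s t : cls s + cls t = cls (s ++ t).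
Proof. exact: tensor_addE. Qed.

Lemma tensor_scalerE a s : a *: cls s = cls [seq (a *: z.1, z.2) | z <- s].
Proof. exact: tensor_scaleE. Qed.

Lemma tens_bilinear : bilinear_map tens.
Proof.
rewrite /tens; split=> [a x x' y|a x y y'].
  by rewrite tensor_scalerE tensor_addrE; apply/tensor_eqP; exact: TRDl.
rewrite tensor_scalerE tensor_addrE; apply/tensor_eqP.
apply: TRtrans (TRDr _ _ _) _.
exact: (TRcat (TRsym (TRZ a x y)) (TRrefl [:: (x, y')])).
Qed.

Lemma tensor_sum (p : tensor) : p = \sum_(z <- repr p) tens z.1 z.2.
Proof.
rewrite -[LHS]reprK; elim: (repr p) => [|[x y] s IH]; first by rewrite big_nil.
by rewrite big_cons -IH /= tensor_addrE.
Qed.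

Definition tensor_lift (W : lmodType K) (f : A -> B -> W) (p : tensor) : W :=
  \sum_(z <- repr p) f z.1 z.2.

Section UniversalProperty.
Variables (W : lmodType K) (f : A -> B -> W) (bf : bilinear_map f).

Lemma tensor_rel_lift s t : tensor_rel s t ->
  \sum_(z <- s) f z.1 z.2 = \sum_(z <- t) f z.1 z.2.
Proof.
elim=> {s t} //=.
- by move=> s t r _ -> _ ->.
- by move=> s s' t t' _ e _ e'; rewrite !big_cat /= e e'.
- by move=> s t; rewrite !big_cat /= addrC.
- by move=> y; rewrite big_cons big_nil /= addr0 bilinear_map0l.
- by move=> x x' y; rewrite !big_cons !big_nil /= !addr0 bilinear_mapDl.
- by move=> x y y'; rewrite !big_cons !big_nil /= !addr0 bilinear_mapDr.
- by move=> a x y; rewrite !big_cons !big_nil /= !addr0 bilinear_mapZl //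
    bilinear_mapZr.
Qed.

Lemma tensor_liftE x y : tensor_lift f (tens x y) = f x y.
Proof.
rewrite /tensor_lift (tensor_rel_lift (tensor_reprP [:: (x, y)])).
by rewrite big_cons big_nil addr0.
Qed.

Lemma tensor_lift_linear : linear (tensor_lift f).
Proof.
move=> a; elim/tensor_ind=> s; elim/tensor_ind=> t.
rewrite tensor_scalerE tensor_addrE.
rewrite /tensor_lift (tensor_rel_lift (tensor_reprP (_ ++ _))).
rewrite (tensor_rel_lift (tensor_reprP s)) (tensor_rel_lift (tensor_reprP t)).
rewrite big_cat big_map /=.
by congr (_ + _); rewrite scaler_sumr; apply: eq_bigr => z _ /=;
  rewrite bilinear_mapZl.
Qed.

Lemma tensor_lift_unique (g : {linear tensor -> W}) :
  (forall x y, g (tens x y) = f x y) -> g =1 tensor_lift f.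
Proof.
move=> gf p; rewrite {1}[p]tensor_sum linear_sum.
by apply: eq_bigr => z _; exact: gf.
Qed.

End UniversalProperty.

End TensorProduct.

Section VertexAlgebras.
Variable K : numFieldType.

Definition binz (m : int) (i : nat) : K :=
  (\prod_(j < i) (m%:~R - j%:R)) / i`!%:R.

(* Operations are recorded apart from the axioms, which are the predicates
   below. [nprod u n v] is u_n v. *)
Record voa_data := VoaData {
  voa_space :> lmodType K;
  nprod : voa_space -> int -> voa_space -> voa_space;
  vacuum : voa_space;
  conformal : voa_space }.

Record mod_data (V : voa_data) := ModData {
  mod_space :> lmodType K;
  act : V -> int -> mod_space -> mod_space }.

Definition adjoint (V : voa_data) : mod_data V := ModData (@nprod V).

Section Modules.
Variables (V : voa_data) (W : mod_data V).

Definition truncation : Prop :=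
  forall (v : V) (w : W), exists N : int,
    forall n : int, N <= n -> act v n w = 0.

Definition vacuum_property : Prop :=
  forall (n : int) (w : W), act (vacuum V) n w = if n == -1 then w else 0.

(* The Jacobi identity, in components: the coefficient of
   x0^(-l-1) x1^(-m-1) x2^(-n-1). By truncation all sums are finite. *)
Definition jacobi_identity : Prop :=
  forall (u v : V) (w : W) (l m n : int),
    \sum_(i \in [set: nat])
      binz m i *: act (nprod u (l + i%:Z) v) (m + n - i%:Z) w
    = \sum_(i \in [set: nat])
      ((-1) ^+ i * binz l i) *:
        (act u (m + l - i%:Z) (act v (n + i%:Z) w)
         - (-1) ^ l *: act v (n + l - i%:Z) (act u (m + i%:Z) w)).

Definition is_weak_module : Prop :=
  [/\ forall n, bilinear_map (fun (v : V) (w : W) => act v n w),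
      truncation, vacuum_property & jacobi_identity].

Definition Lop (n : int) (w : W) : W := act (conformal V) (n + 1) w.

Definition gen_eigenspace (h : K) : set W :=
  [set w | exists k : nat, iter k (fun x => Lop 0 x - h *: x) w = 0].

Definition is_generalized_module : Prop :=
  is_weak_module /\ direct_sum gen_eigenspace.

Definition is_grading_restricted : Prop :=
  forall h : K, finite_dimensional (gen_eigenspace h) /\
    exists N : int, forall n : int, n <= N ->
      gen_eigenspace (h + n%:~R) = [set 0].

Definition is_gr_module : Prop :=
  is_generalized_module /\ is_grading_restricted.

End Modules.

Definition weight_space (V : voa_data) (n : int) : set V :=
  [set v | Lop (W := adjoint V) 0 v = n%:~R *: v].

Definition virasoro_relations (V : voa_data) : Prop :=
  let L := @Lop V (adjoint V) in
  exists c : K, forall (m n : int) (v : V),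
    L m (L n v) - L n (L m v) =
    (m - n)%:~R *: L (m + n) v +
    (if m + n == 0 then ((m ^+ 3 - m)%:~R / 12%:R) * c else 0) *: v.

Definition is_voa (V : voa_data) : Prop :=
  [/\ is_weak_module (adjoint V) /\
      (forall v : V, nprod v (-1) (vacuum V) = v /\
         forall n : int, 0 <= n -> nprod v n (vacuum V) = 0),
      virasoro_relations V,
      forall (v w : V) (n : int),
        nprod (Lop (W := adjoint V) (-1) v) n w
        = (- n)%:~R *: nprod v (n - 1) w,
      direct_sum (@weight_space V) &
      (forall n, finite_dimensional (@weight_space V n)) /\
      exists N : int, forall n : int, n <= N -> weight_space n = [set 0 : V]].

Definition N_graded (V : voa_data) : Prop :=
  forall n : int, n < 0 -> weight_space n = [set 0 : V].

Section Submodules.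
Variables (V : voa_data) (W : mod_data V).

Record submodule := Submodule {
  sub_set :> set W;
  sub0 : sub_set 0;
  subP : forall (a : K) (x y : W),
    sub_set x -> sub_set y -> sub_set (a *: x + y);
  sub_act : forall (v : V) (n : int) (x : W),
    sub_set x -> sub_set (act v n x) }.

Definition sub_pred (S : submodule) : {pred W} := fun x => `[< sub_set S x >].

Lemma sub_pred_closed (S : submodule) : submod_closed (sub_pred S).
Proof.
split=> [|a x y /asboolP Sx /asboolP Sy]; apply/asboolP; first exact: sub0.
exact: subP.
Qed.

HB.instance Definition _ (S : submodule) :=
  GRing.isSubmodClosed.Build K W (sub_pred S) (sub_pred_closed S).

Definition sub_space (S : submodule) : Type := {x : W | x \in sub_pred S}.
HB.instance Definition _ (S : submodule) :=
  SubChoice.on (sub_space S).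
HB.instance Definition _ (S : submodule) :=
  [SubChoice_isSubLmodule of sub_space S by <:].

Lemma sub_act_mem (S : submodule) v n (x : sub_space S) :
  act v n (val x) \in sub_pred S.
Proof. by apply/asboolP/sub_act; apply/asboolP/(valP x). Qed.

Definition sub_mod (S : submodule) : mod_data V :=
  @ModData V (sub_space S : lmodType K)
    (fun v n x => exist _ (act v n (val x)) (sub_act_mem v n x)).

Definition generated_set (x : W) : set W :=
  [set y | forall S : submodule, sub_set S x -> sub_set S y].

Lemma generated0 x : generated_set x 0.
Proof. by move=> S _; exact: sub0. Qed.

Lemma generatedP x (a : K) (y z : W) : generated_set x y ->
  generated_set x z -> generated_set x (a *: y + z).
Proof. by move=> xy xz S Sx; apply: subP; [exact: xy | exact: xz]. Qed.

Lemma generated_act x (v : V) n (y : W) :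
  generated_set x y -> generated_set x (act v n y).
Proof. by move=> xy S Sx; apply: sub_act; exact: xy. Qed.

Definition generated (x : W) : submodule :=
  Submodule (@generated0 x) (@generatedP x) (@generated_act x).

(* A composition series: each term is a maximal proper submodule of the
   next one. *)
Definition finite_length : Prop :=
  exists (n : nat) (F : nat -> submodule),
    [/\ F 0%N = [set 0] :> set W, F n = [set: W] :> set W &
      forall i, (i < n)%N ->
        F i `<` F i.+1 /\
        forall N : submodule, F i `<=` N -> N `<=` F i.+1 ->
          N = F i :> set W \/ N = F i.+1 :> set W].

Definition C1_space : set W :=
  span [set x | exists (v : V) (n : int) (w : W),
    [/\ weight_space n v, 0 < n & x = act v (-1) w]].

End Submodules.

Arguments C1_space {V} W _.

(* Full subcategories closed under isomorphisms are given by their objects. *)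
Definition category (V : voa_data) := mod_data V -> Prop.

Definition C1_category (V : voa_data) : category V :=
  fun W => is_gr_module W /\ finite_codimensional (C1_space W).

Definition closed_under_submodules (V : voa_data) (C : category V) : Prop :=
  forall W : mod_data V, C W -> forall S : submodule W, C (sub_mod S).

Definition all_finite_length (V : voa_data) (C : category V) : Prop :=
  forall W : mod_data V, C W -> finite_length W.

Section TensorVOA.
Variables U V : voa_data.

(* Bilinear extension of
   (u (x) v)_n (u' (x) v') = \sum_(j + k = n - 1) u_j u' (x) v_k v',
   the coefficient of x^(-n-1) in Y(u,x)u' (x) Y(v,x)v'; see
   [tensor_nprod_tens]. *)
Definition tensor_nprod (p : tensor U V) (n : int) (q : tensor U V) :
    tensor U V :=
  tensor_lift (fun u v =>
    tensor_lift (fun u' v' =>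
      \sum_(j \in [set: int]) tens (nprod u j u') (nprod v (n - 1 - j) v')) q) p.

Lemma fsumP (W : lmodType K) (a : K) (F G H : int -> W) :
  (exists A : seq int, forall j, j \notin A -> F j = 0) ->
  (exists A : seq int, forall j, j \notin A -> G j = 0) ->
  (forall j, H j = a *: F j + G j) ->
  \sum_(j \in [set: int]) H j
  = a *: \sum_(j \in [set: int]) F j + \sum_(j \in [set: int]) G j.
Proof.
move=> [A FA] [B GB] HFG; pose r := undup (A ++ B).
have Er (E : int -> W) : (forall j, j \notin r -> E j = 0) ->
    \sum_(j \in [set: int]) E j = \sum_(j <- r) E j.
  move=> E0; rewrite (fsbigE r) ?undup_uniq //; last by move=> j _; exact: E0.
  by apply: eq_bigl => j; rewrite in_setT.
have Fr j : j \notin r -> F j = 0.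
  by rewrite mem_undup mem_cat negb_or => /andP[/FA].
have Gr j : j \notin r -> G j = 0.
  by rewrite mem_undup mem_cat negb_or => /andP[_ /GB].
rewrite (Er F Fr) (Er G Gr) (Er H) => [|j jr]; last first.
  by rewrite HFG Fr // Gr // scaler0 addr0.
rewrite scaler_sumr -big_split.
by apply: eq_bigr => j _; rewrite HFG.
Qed.

Lemma tensor_nprod_tens (n : int) (u u' : U) (v v' : V) :
  is_weak_module (adjoint U) -> is_weak_module (adjoint V) ->
  tensor_nprod (tens u v) n (tens u' v')
  = \sum_(j \in [set: int]) tens (nprod u j u') (nprod v (n - 1 - j) v').
Proof.
move=> [/= bU tU _ _] [/= bV tV _ _].
have fin x y x' y' : exists A : seq int, forall j, j \notin A ->
    tens (nprod x j x' : U) (nprod y (n - 1 - j) y' : V) = 0.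
  have [M /= xM] := tU x x'; have [N /= yN] := tV y y'.
  exists [seq (n - N + i%:Z)%R | i <- iota 0 `|(M - (n - N))%R|%N] => j /mapP jA.
  have [Mj|jM] := leP M j.
    by rewrite xM // (bilinear_map0l _ (tens_bilinear _ _)).
  have [Nj|jN] := leP N (n - 1 - j).
    by rewrite yN // (bilinear_map0r _ (tens_bilinear _ _)).
  case: jA; exists `|(j - (n - N))%R|%N; first by rewrite mem_iota; lia.
  by lia.
have bf x y : bilinear_map (fun u' v' =>
    \sum_(j \in [set: int]) tens (nprod x j u' : U) (nprod y (n - 1 - j) v' : V)).
  split=> [a z z' t|a z t t']; apply: fsumP => // j.
    by rewrite (proj2 (bU j)) (proj1 (tens_bilinear U V)).
  by rewrite (proj2 (bV _)) (proj2 (tens_bilinear U V)).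
rewrite /tensor_nprod !tensor_liftE //.
split=> [a x x' y|a x y y']; rewrite /tensor_lift scaler_sumr -big_split;
  apply: eq_bigr => z _; apply: fsumP => // j.
  by rewrite (proj1 (bU j)) (proj1 (tens_bilinear U V)).
by rewrite (proj1 (bV _)) (proj2 (tens_bilinear U V)).
Qed.

Definition tensor_voa : voa_data :=
  @VoaData (tensor U V : lmodType K) tensor_nprod
    (tens (vacuum U) (vacuum V))
    (tens (conformal U) (vacuum V) + tens (vacuum U) (conformal V)).

Definition restrict_left (X : mod_data tensor_voa) : mod_data U :=
  @ModData U (mod_space X) (fun u => act (tens u (vacuum V) : tensor_voa)).

Definition restrict_right (X : mod_data tensor_voa) : mod_data V :=
  @ModData V (mod_space X) (fun v => act (tens (vacuum U) v : tensor_voa)).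

Definition D_category (CU : category U) (CV : category V) :
    category tensor_voa :=
  fun X => [/\ is_gr_module X, finite_length X,
     forall x : X, CU (sub_mod (generated (W := restrict_left X) x)) &
     forall x : X, CV (sub_mod (generated (W := restrict_right X) x))].

End TensorVOA.

End VertexAlgebras.

(* Main.v *)
(* Let X be a C_1-cofinite U (x) V-module.  Its two commuting Virasoro zero
   modes L^U(0), L^V(0) decompose X into finite-dimensional simultaneous
   generalized eigenspaces.  Since C_1(X) lies in C_1^U(X) + C_1^V(X), an
   induction on the total weight shows that X / C_1^U(X) has only finitely many
   L^U(0)-weights; hence the L^V(0)-weight spaces of X, which are U-submodules,
   are C_1-cofinite over U, and so are all U-submodules generated by one vector.
   For the length of X: X is a sum of V-homomorphic images of finitely many
   V-modules of finite length, so a finite set H of L^V(0)-weights, one for each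
   composition factor, detects proper inclusions of U (x) V-submodules; the sum
   of the L^V(0)-weight spaces for H has finite length over U, which bounds the
   length of X.
   Conversely, if X in D(C_U^1, C_V^1) is generated by x_1, ..., x_n, then
   V x_i is finite-dimensional modulo C_1^V, so X is spanned modulo C_1(X) by
   finitely many U t, and each of these is finite-dimensional modulo C_1^U. *)
From mathcomp Require Import all_boot all_order all_algebra.
From mathcomp Require Import boolp classical_sets functions fsbigop.
From mathcomp Require Import reals zify ring.
From mathcomp.real_closed Require Import complex.
Require Import Defs.
Set Implicit Arguments.
Unset Strict Implicit.
Unset Printing Implicit Defensive.
Import Order.TTheory GRing.Theory Num.Theory.
Local Open Scope classical_set_scope.
Local Open Scope ring_scope.

(** * Subspaces of arbitrary vector spaces *)

Section Subspaces.
Variables (K : fieldType) (X : lmodType K).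
Implicit Types (A B : set X).

(** The obstacle is that little is known about X over one factor alone: its L^U(0)-weight spaces may
    be infinite-dimensional, and X need not have finite length over U or over V. Finiteness over U
    appears only once an L^V(0)-weight is fixed as well, because the two weights together determine
    the total weight. For the length, X may contain infinitely many homomorphic images of the same
    V-modules, so their lengths cannot be added up; but all composition factors come from one finite
    list, and in each factor a single nonzero weight space tells whether the factor is present in a
    quotient Q / P. The gradings by nonnegative weights enter through the inclusion of C_1(X) in
    C_1^U(X) + C_1^V(X): a homogeneous u (x) v of positive weight has a factor of positive weight
    and none of negative weight. Algebraic closedness of the field enters when L^U(0) is split off
    from the total zero mode. *)

Definition subspace A : Prop :=
  A 0 /\ forall (a : K) x y, A x -> A y -> A (a *: x + y).

Lemma subspaceD A x y : subspace A -> A x -> A y -> A (x + y).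
Proof. by move=> [_ h] Ax Ay; rewrite -[x]scale1r; exact: h. Qed.

Lemma subspaceZ A a x : subspace A -> A x -> A (a *: x).
Proof. by move=> [A0 h] Ax; rewrite -[_ *: _]addr0; exact: h. Qed.

Lemma subspaceN A x : subspace A -> A x -> A (- x).
Proof. by move=> sA Ax; rewrite -scaleN1r; exact: subspaceZ. Qed.

Lemma subspaceB A x y : subspace A -> A x -> A y -> A (x - y).
Proof. by move=> sA Ax Ay; apply: subspaceD => //; exact: subspaceN. Qed.

Lemma subspace_sum A (I : eqType) (r : seq I) (P : pred I) (F : I -> X) :
  subspace A -> (forall i, i \in r -> P i -> A (F i)) ->
  A (\sum_(i <- r | P i) F i).
Proof.
move=> sA AF; rewrite big_seq_cond; elim/big_ind: _ => [|x y|i /andP[]].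
- exact: sA.1.
- exact: subspaceD.
- exact: AF.
Qed.

Lemma subspace_fsum A (I : choiceType) (D : set I) (F : I -> X) :
  subspace A -> (forall i, A (F i)) -> A (\sum_(i \in D) F i).
Proof. by move=> sA AF; apply: subspace_sum. Qed.

Lemma subspace_span A : subspace (span A).
Proof.
split; first by exists 0%N, (fun=> 0), (fun=> 0); rewrite big_ord0; split=> // -[].
move=> c _ _ [n [a [x [Ax ->]]]] [m [b [y [Ay ->]]]].
exists (n + m)%N, (fun k => match fintype.split k with inl i => c * a i | inr j => b j end).
exists (fun k => match fintype.split k with inl i => x i | inr j => y j end); split.
  by move=> k; case: fintype.split.
rewrite big_split_ord /= scaler_sumr; congr (_ + _); apply: eq_bigr => i _.
  by rewrite (unsplitK (inl i)) scalerA.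
by rewrite (unsplitK (inr i)).
Qed.

Lemma span_min A B : subspace B -> A `<=` B -> span A `<=` B.
Proof.
move=> sB AB _ [n [a [x [Ax ->]]]]; apply: subspace_sum => // i _ _.
by apply: subspaceZ => //; apply: AB.
Qed.

Lemma sub_span A : A `<=` span A.
Proof.
move=> x Ax; exists 1%N, (fun=> 1), (fun=> x); split=> //.
by rewrite big_ord1 scale1r.
Qed.

Lemma span_mono A B : A `<=` B -> span A `<=` span B.
Proof.
move=> AB; apply: span_min; first exact: subspace_span.
by move=> x Ax; apply: sub_span; exact: AB.
Qed.

Lemma subspaceI A B : subspace A -> subspace B -> subspace (A `&` B).
Proof.
move=> [A0 hA] [B0 hB]; split=> // a x y [Ax Bx] [Ay By].
by split; [exact: hA | exact: hB].
Qed.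

Definition sumset A B : set X := [set z | exists x y, [/\ A x, B y & z = x + y]].

Lemma subspace_sumset A B : subspace A -> subspace B -> subspace (sumset A B).
Proof.
move=> sA sB; split; first by exists 0, 0; split; rewrite ?addr0; [exact: sA.1 | exact: sB.1|].
move=> a _ _ [x [y [Ax By ->]]] [x' [y' [Ax' By' ->]]].
exists (a *: x + x'), (a *: y + y'); split; [exact: sA.2 | exact: sB.2 |].
by rewrite scalerDr addrACA.
Qed.

Lemma sumsetl A B : subspace B -> A `<=` sumset A B.
Proof. by move=> [B0 _] x Ax; exists x, 0; rewrite addr0. Qed.

Lemma sumsetr A B : subspace A -> B `<=` sumset A B.
Proof. by move=> [A0 _] x Bx; exists 0, x; rewrite add0r. Qed.

(* The vectors [e i] are not required to lie in [A]. *)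
Definition bounded_dim A : Prop :=
  exists (n : nat) (e : 'I_n -> X),
    forall w, A w -> exists a : 'I_n -> K, w = \sum_(i < n) a i *: e i.

Lemma bounded_dim_mono A B : A `<=` B -> bounded_dim B -> bounded_dim A.
Proof. by move=> AB [n [e h]]; exists n, e => w /AB/h. Qed.

Lemma finite_dimensional_bounded A : finite_dimensional A -> bounded_dim A.
Proof. by move=> [n [e [_ h]]]; exists n, e. Qed.

Lemma bounded_dim_sumset A B :
  bounded_dim A -> bounded_dim B -> bounded_dim (sumset A B).
Proof.
move=> [n [e he]] [m [f hf]]; exists (n + m)%N.
exists (fun k => match fintype.split k with inl i => e i | inr j => f j end).
move=> _ [x [y [/he[a ->] /hf[b ->] ->]]].
exists (fun k => match fintype.split k with inl i => a i | inr j => b j end).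
rewrite big_split_ord /=; congr (_ + _); apply: eq_bigr => i _.
  by rewrite (unsplitK (inl i)).
by rewrite (unsplitK (inr i)).
Qed.

(** Induction on the number of spanning vectors: a single vector of [A] with nonzero last
    coefficient clears that coefficient from all others, which then lie in the subspace [A'] of the
    induction hypothesis. *)
Lemma bounded_dim_finite A : subspace A -> bounded_dim A -> finite_dimensional A.
Proof.
move=> sA [n [e he]]; elim: n A e sA he => [|n IH] A e sA he.
  exists 0%N, e; split; first by case.
  exact: he.
pose A' := [set w | A w /\ exists a : 'I_n -> K,
  w = \sum_(i < n) a i *: e (widen_ord (leqnSn n) i)].
have sA' : subspace A'.
  split.
    by split; [exact: sA.1 | exists (fun=> 0); rewrite big1 // => i _; rewrite scale0r].
  move=> c x y [Ax [a ea]] [Ay [b eb]]; split; first exact: sA.2.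
  exists (fun i => c * a i + b i); rewrite ea eb scaler_sumr -big_split.
  by apply: eq_bigr => i _ /=; rewrite scalerDl scalerA.
have [m [f [Af hf]]] : finite_dimensional A' 
  by apply: (IH A' (fun i => e (widen_ord (leqnSn n) i)) sA') => w [_ h]; exact: h.
have [[w0 [Aw0 [a [ea an0]]]]|no] :=
    pselect (exists w0, A w0 /\ exists a : 'I_n.+1 -> K,
      w0 = \sum_(i < n.+1) a i *: e i /\ a ord_max != 0).
  exists m.+1, (fun k => match unlift ord_max k with Some i => f i | None => w0 end).
  split=> [k|w Aw]; first by case: unlift => // i; case: (Af i).
  have [b eb] := he w Aw.
  pose c := b ord_max / a ord_max.
  have [d ed] : exists d : 'I_m -> K, w - c *: w0 = \sum_(i < m) d i *: f i.
    apply: hf; split; first by apply: subspaceB => //; exact: subspaceZ.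
    exists (fun i => b (widen_ord (leqnSn n) i) - c * a (widen_ord (leqnSn n) i)).
    rewrite eb ea !big_ord_recr /= scalerDr scalerA /c divfK // opprD addrACA subrr.
    rewrite addr0 scaler_sumr -sumrB; apply: eq_bigr => i _.
    by rewrite scalerBl scalerA.
  exists (fun k => match unlift ord_max k with Some i => d i | None => c end).
  rewrite big_ord_recr /= unlift_none.
  rewrite -[LHS](subrK (c *: w0)) ed; congr (_ + _); apply: eq_bigr => i _.
  have -> : widen_ord (leqnSn m) i = lift ord_max i.
    by apply: val_inj; rewrite /= /bump leqNgt ltn_ord add0n.
  by rewrite liftK.
exists m, f; split=> [i|w Aw]; first by case: (Af i).
apply: hf; split=> //; have [b eb] := he w Aw.
have b0 : b ord_max = 0.
  by apply/eqP/negPn/negP => bn0; apply: no; exists w; split=> //; exists b.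
exists (fun i => b (widen_ord (leqnSn n) i)).
by rewrite eb big_ord_recr /= b0 scale0r addr0.
Qed.

Lemma bounded_dim_big_sum (I : eqType) (s : seq I) (B : I -> set X) :
  (forall i, i \in s -> bounded_dim (B i)) ->
  bounded_dim [set z | exists f : I -> X,
    (forall i, i \in s -> B i (f i)) /\ z = \sum_(i <- s) f i].
Proof.
elim: s => [|i s IH] hB.
  exists 0%N, (fun=> 0) => w [f [_ ->]]; exists (fun=> 0).
  by rewrite big_nil big_ord0.
apply: (@bounded_dim_mono _ (sumset (B i) [set z | exists f : I -> X,
    (forall i, i \in s -> B i (f i)) /\ z = \sum_(i <- s) f i])).
  move=> _ [f [Bf ->]]; exists (f i), (\sum_(j <- s) f j).
  split; [by apply: Bf; rewrite mem_head | exists f; split=> // j js |].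
    by apply: Bf; rewrite inE js orbT.
  by rewrite big_cons.
apply: bounded_dim_sumset; first by apply: hB; rewrite mem_head.
by apply: IH => j js; apply: hB; rewrite inE js orbT.
Qed.

End Subspaces.

Section LinearMaps.
Variables (K : fieldType) (X Y : lmodType K) (f : X -> Y).
Hypothesis flin : linear f.

Lemma lin0 : f 0 = 0.
Proof. by have := flin (-1) 0 0; rewrite scaler0 addr0 scaleN1r addNr. Qed.

Lemma linD x y : f (x + y) = f x + f y.
Proof. by rewrite -[x in LHS]scale1r flin scale1r. Qed.

Lemma linZ a x : f (a *: x) = a *: f x.
Proof. by rewrite -[_ *: _]addr0 flin lin0 addr0. Qed.

Lemma linN x : f (- x) = - f x.
Proof. by rewrite -scaleN1r linZ scaleN1r. Qed.

Lemma linB x y : f (x - y) = f x - f y.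
Proof. by rewrite linD linN. Qed.

Lemma lin_sum (I : Type) (r : seq I) (P : pred I) (F : I -> X) :
  f (\sum_(i <- r | P i) F i) = \sum_(i <- r | P i) f (F i).
Proof. by elim/big_rec2: _ => [|i x y _ <-]; rewrite ?lin0 ?linD. Qed.

(** A sum with infinite support is 0 by convention. Injectivity of [f] gives [F] and [f \o F] the
    same support, so both sides fall under the same case. *)
Lemma lin_fsum (I : choiceType) (D : set I) (F : I -> X) : injective f ->
  f (\sum_(i \in D) F i) = \sum_(i \in D) f (F i).
Proof.
move=> finj; rewrite lin_sum /finite_support !unlock.
set A := D `&` _; set B := D `&` _; suff -> : A = B by [].
rewrite predeqE => i; split=> -[Di /= Fi]; split=> //= h; apply: Fi.
  by apply: finj; rewrite h lin0.
by rewrite h lin0.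
Qed.

Lemma subspace_preimage (B : set Y) : subspace B -> subspace (f @^-1` B).
Proof.
move=> sB; split; first by rewrite /preimage /= lin0; exact: sB.1.
by move=> a x y Bx By; rewrite /preimage /= flin; exact: sB.2.
Qed.

Lemma subspace_image (A : set X) : subspace A -> subspace (f @` A).
Proof.
move=> sA; split; first by exists 0; [exact: sA.1 | exact: lin0].
move=> a _ _ [x Ax <-] [y Ay <-]; exists (a *: x + y); first exact: sA.2.
exact: flin.
Qed.

End LinearMaps.

Lemma linear_iter (K : fieldType) (X : lmodType K) (f : X -> X) k :
  linear f -> linear (iter k f).
Proof. by move=> flin; elim: k => // k IH a x y; rewrite !iterS IH flin. Qed.

(** * Generalized eigenspaces and their projections *)

Section GeneralizedEigenspaces.
Variables (K : fieldType) (X : lmodType K) (T : X -> X).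
Hypothesis Tlin : linear T.
Implicit Types (P : set X) (h c : K).

Definition shift c x : X := T x - c *: x.

Lemma shift_linear c : linear (shift c).
Proof.
move=> a x y; rewrite /shift Tlin scalerDr opprD addrACA; congr (_ + _).
by rewrite scalerBr !scalerA mulrC.
Qed.

(** For [T := Lop 0] this unfolds to [gen_eigenspace]; an abstract [T] covers L^U(0), L^V(0) and
    their sum alike. *)
Definition geig h : set X := [set x | exists k, iter k (shift h) x = 0].

Lemma iter_shift0 h k m x : iter k (shift h) x = 0 -> iter (m + k) (shift h) x = 0.
Proof. by rewrite iterD => ->; rewrite (lin0 (linear_iter _ (shift_linear h))). Qed.

Lemma subspace_geig h : subspace (geig h).
Proof.
split; first by exists 0%N.
move=> a x y [k hk] [m hm]; exists (m + k)%N.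
rewrite (linear_iter _ (shift_linear h)) (iter_shift0 _ hk) scaler0 add0r.
by rewrite addnC (iter_shift0 _ hm).
Qed.

(** The relation [T, S] = c S says that [S] intertwines [T - h] with [T - (h + c)]. *)
Lemma geig_move (S : X -> X) c h x : linear S ->
  (forall y, T (S y) = S (T y) + c *: S y) -> geig h x -> geig (h + c) (S x).
Proof.
move=> Slin TS [k hk]; exists k.
have e y : shift (h + c) (S y) = S (shift h y).
  by rewrite /shift TS (linB Slin) (linZ Slin) scalerDl opprD addrACA subrr addr0.
suff -> : iter k (shift (h + c)) (S x) = S (iter k (shift h) x).
  by rewrite hk (lin0 Slin).
by elim: k {hk} => // k IH; rewrite !iterS IH e.
Qed.

Lemma geig_comm (S : X -> X) h x : linear S ->
  (forall y, T (S y) = S (T y)) -> geig h x -> geig h (S x).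
Proof.
move=> Slin TS hx; rewrite -[h]addr0; apply: geig_move => // y.
by rewrite TS scale0r addr0.
Qed.

Definition stable P : Prop := subspace P /\ forall x, P x -> P (T x).

Lemma stable_shift P c x : stable P -> P x -> P (shift c x).
Proof.
move=> [sP TP] Px; apply: subspaceB => //; first exact: TP.
exact: subspaceZ.
Qed.

Lemma stable_iter_shift P c k x : stable P -> P x -> P (iter k (shift c) x).
Proof. by move=> sP Px; elim: k => // k IH; rewrite iterS; exact: stable_shift. Qed.

Lemma shiftC b c x : shift b (shift c x) = shift c (shift b x).
Proof.
rewrite /shift !(linB Tlin) !(linZ Tlin) !scalerBr !opprB !scalerA.
by rewrite [b * c]mulrC addrACA [RHS]addrACA [X in _ + X]addrC.
Qed.

(* [shift b x - shift c x] is a nonzero multiple of [x], so that the two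
   coprime powers of shifts generate [x]. *)
Lemma stable_coprime P b c k m x : stable P -> b != c ->
  P (iter k (shift b) x) -> P (iter m (shift c) x) -> P x.
Proof.
move=> sP bc; move: {2}(k + m)%N (leqnn (k + m)) => N.
elim: N => [|N IH] in k m x *.
  by rewrite leqn0 addn_eq0 => /andP[/eqP-> _].
case: k => [//|k]; case: m => [//|m] kmN Pb Pc.
have Pbx : P (shift b x).
  apply: (IH k m.+1); first by lia.
    by rewrite -iterSr.
  have -> : iter m.+1 (shift c) (shift b x) = shift b (iter m.+1 (shift c) x).
    elim: (m.+1) => // j ih; by rewrite !iterS ih shiftC.
  exact: stable_shift.
have Pcx : P (shift c x).
  apply: (IH k.+1 m); first by lia.
    have -> : iter k.+1 (shift b) (shift c x) = shift c (iter k.+1 (shift b) x).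
      elim: (k.+1) => // j ih; by rewrite !iterS ih shiftC.
    exact: stable_shift.
  by rewrite -iterSr.
have {1}-> : x = (c - b)^-1 *: (shift b x - shift c x).
  rewrite /shift opprB [X in _ *: X]addrC addrA subrK -scalerBl.
  by rewrite scalerA mulVf ?scale1r // subr_eq0 eq_sym.
apply: subspaceZ; first exact: sP.1.
by apply: subspaceB => //; exact: sP.1.
Qed.

End GeneralizedEigenspaces.

Section Decomposition.
Variables (K : fieldType) (X : lmodType K) (T : X -> X).
Hypothesis Tlin : linear T.
Implicit Types (P : set X) (h c : K) (s : seq K) (f g : K -> X).

(** The family must vanish off [s]; this makes it unique as a function on all of [K], whatever list
    is chosen. *)
Definition decomp x s f : Prop :=
  [/\ uniq s, forall h, geig T h (f h), forall h, h \notin s -> f h = 0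
    & x = \sum_(h <- s) f h].

Definition decomposable x : Prop := exists s f, decomp x s f.

Lemma big_supp (s r : seq K) f : uniq s -> uniq r -> {subset s <= r} ->
  (forall h, h \notin s -> f h = 0) -> \sum_(h <- r) f h = \sum_(h <- s) f h.
Proof.
move=> us ur sr f0; rewrite (bigID (mem s)) /= addrC big1 ?add0r //.
rewrite -big_filter; apply: perm_big; apply: uniq_perm => //.
  exact: filter_uniq.
by move=> h; rewrite mem_filter /=; case: (boolP (h \in s)) => //= /sr.
Qed.

Lemma decomp_lin a x y s s' f g : decomp x s f -> decomp y s' g ->
  decomp (a *: x + y) (undup (s ++ s')) (fun h => a *: f h + g h).
Proof.
move=> [us fh f0 ->] [us' gh g0 ->]; split.
- exact: undup_uniq.
- by move=> h; apply: (subspace_geig Tlin h).2.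
- move=> h; rewrite mem_undup mem_cat negb_or => /andP[/f0-> /g0->].
  by rewrite scaler0 addr0.
- rewrite big_split -scaler_sumr /=; congr (_ *: _ + _).
    symmetry; apply: big_supp => //; first exact: undup_uniq.
    by move=> h hs; rewrite mem_undup mem_cat hs.
  symmetry; apply: big_supp => //; first exact: undup_uniq.
  by move=> h hs; rewrite mem_undup mem_cat hs orbT.
Qed.

(** A power of [T - h1] kills the first component and leaves a shorter sum, so by induction it maps
    every other component into [P]; a power of [T - h] kills the component at [h], and the two
    powers are coprime. *)
Lemma stable_components P s f : stable T P -> uniq s ->
  (forall h, geig T h (f h)) -> P (\sum_(h <- s) f h) ->
  forall h, h \in s -> P (f h).
Proof.
move=> sP us fh; elim: s f us fh => [//|h1 s IH] f /= /andP[h1s us] fh Px.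
have [k hk] := fh h1.
have ilin := linear_iter k (shift_linear Tlin h1).
have Pf h : h \in s -> P (f h).
  move=> hs; have h1h : h1 != h by apply: contraNneq h1s => ->.
  have [m hm] := fh h.
  apply: (@stable_coprime _ _ T Tlin P h1 h k m _ sP h1h); last first.
    by rewrite hm; exact: sP.1.1.
  apply: (IH (fun h => iter k (shift T h1) (f h))) => //.
    move=> h'; apply: geig_comm (fh h') => // y.
    elim: k {hk ilin} => // j ih; rewrite !iterS -ih.
    by rewrite /shift (linB Tlin) (linZ Tlin).
  rewrite -(lin_sum ilin); have := stable_iter_shift h1 k sP Px.
  by rewrite big_cons (linD ilin) hk add0r.
move=> h; rewrite inE => /orP[/eqP->|]; last exact: Pf.
have -> : f h1 = \sum_(h <- h1 :: s) f h - \sum_(h <- s) f h.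
  by rewrite big_cons addrK.
apply: subspaceB => //; first exact: sP.1.
by apply: subspace_sum => [|i /Pf]; [exact: sP.1|].
Qed.

Lemma decomp_stable P x s f : stable T P -> P x -> decomp x s f ->
  forall h, P (f h).
Proof.
move=> sP Px [us fh f0 ex] h; have [hs|/f0->] := boolP (h \in s); last exact: sP.1.1.
by apply: (@stable_components P s f) => //; rewrite -ex.
Qed.

Lemma stable0 : stable T [set 0].
Proof.
split; last by move=> _ ->; exact: lin0.
by split=> // a _ _ -> ->; rewrite scaler0 addr0.
Qed.

Lemma decomp_unique x s s' f g : decomp x s f -> decomp x s' g -> f =1 g.
Proof.
move=> df dg h; have := decomp_lin (-1) df dg.
rewrite scaleN1r addNr => /(@decomp_stable [set 0]) /(_ h) /=.
by rewrite scaleN1r addrC => e; apply/esym/subr0_eq/e => //; exact: stable0.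
Qed.

Lemma decomp_geig h x : geig T h x ->
  decomp x [:: h] (fun h' => if h' == h then x else 0).
Proof.
move=> hx; split=> //.
- move=> h'; case: eqP => [->//|_]; exact: (subspace_geig Tlin h').1.
- by move=> h'; rewrite inE => /negPf->.
- by rewrite big_seq1 eqxx.
Qed.

Lemma subspace_decomposable : subspace decomposable.
Proof.
split; first by exists [::], (fun=> 0); split; rewrite ?big_nil // => h; exact: (subspace_geig Tlin h).1.
move=> a x y [s [f df]] [s' [g dg]].
by exists (undup (s ++ s')), (fun h => a *: f h + g h); exact: decomp_lin.
Qed.

Lemma geig_decomposable h x : geig T h x -> decomposable x.
Proof. by move=> hx; exists [:: h], (fun h' => if h' == h then x else 0); exact: decomp_geig. Qed.

(* On the generalized eigenspace of [h != c], [T - c] is invertible: it is the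
   sum of the nonzero scalar [h - c] and a nilpotent map. *)
Lemma shift_surj c h x : h != c -> geig T h x ->
  exists2 y, geig T h y & shift T c y = x.
Proof.
move=> hc [k]; elim: k x => [|k IH] x.
  by move=> /= ->; exists 0; [exact: (subspace_geig Tlin h).1 | exact: lin0 (shift_linear Tlin c)].
have d0 : h - c != 0 by rewrite subr_eq0.
have ilin j := linear_iter j (shift_linear Tlin h).
rewrite iterSr => kx.
have [|y hy ey] := IH ((h - c)^-1 *: shift T h x).
  by rewrite (linZ (ilin k)) kx scaler0.
exists ((h - c)^-1 *: x - y).
  apply: subspaceB => //; first exact: subspace_geig.
  apply: subspaceZ; first exact: subspace_geig.
  by exists k.+1; rewrite iterSr.
rewrite (linB (shift_linear Tlin c)) ey (linZ (shift_linear Tlin c)) -scalerBr.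
rewrite /shift opprB [X in _ *: X]addrC addrA subrK -scalerBl.
by rewrite scalerA mulVf // scale1r.
Qed.

(** Solving [(T - c) y = f h] for each component with [h != c] and subtracting the solutions leaves
    a vector [z] that [T - c] maps into the generalized eigenspace of [c], so [z] lies there
    itself. *)
Lemma decomposable_shift c x : decomposable (shift T c x) -> decomposable x.
Proof.
move=> [s [f [us fh f0 ex]]].
have /boolp.choice[g gP] : forall h, exists y, geig T h y /\ (h != c -> shift T c y = f h).
  move=> h; have [hc|hc] := boolP (h != c); last by exists 0; split=> //; exact: (subspace_geig Tlin h).1.
  by have [y hy ey] := shift_surj hc (fh h); exists y.
pose z := x - \sum_(h <- s | h != c) g h.
have zc : geig T c z.
  have [k hk] : geig T c (shift T c z).
    rewrite /z (linB (shift_linear Tlin c)) (lin_sum (shift_linear Tlin c)) ex.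
    rewrite [X in _ - X](eq_bigr f) => [|h /(gP h).2//].
    rewrite (bigID (fun h => h != c)) /= [X in X - _]addrC addrK.
    apply: subspace_sum => [|h _]; first exact: subspace_geig.
    by rewrite negbK => /eqP <-.
  by exists k.+1; rewrite iterSr.
rewrite -[x](subrK (\sum_(h <- s | h != c) g h)).
apply: (subspaceD subspace_decomposable); first exact: geig_decomposable zc.
apply: (subspace_sum subspace_decomposable) => h _ _.
exact: geig_decomposable (gP h).1.
Qed.

Definition poly_apply (p : {poly K}) x : X :=
  \sum_(i < size p) p`_i *: iter i T x.

Lemma poly_applyE (p : {poly K}) n x : (size p <= n)%N ->
  poly_apply p x = \sum_(i < n) p`_i *: iter i T x.
Proof.
move=> pn; rewrite /poly_apply (big_ord_widen n (fun i => p`_i *: iter i T x)) //.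
rewrite [RHS](bigID (fun i : 'I_n => (i < size p)%N)) /= [X in _ + X]big1 ?addr0 //.
by move=> i; rewrite -leqNgt => /leq_sizeP/(_ _ (leqnn _))->; rewrite scale0r.
Qed.

Lemma poly_apply_mulXsubC (p : {poly K}) c x :
  poly_apply (p * ('X - c%:P)) x = poly_apply p (shift T c x).
Proof.
have sn : (size (p * ('X - c%:P))%R <= (size p).+1)%N.
  by have [->|p0] := eqVneq p 0; rewrite ?mul0r ?size_poly0 // size_Mmonic ?monicXsubC // size_XsubC addn2.
rewrite (poly_applyE _ sn) /poly_apply.
have -> : \sum_(i < (size p).+1) (p * ('X - c%:P))`_i *: iter i T x =
    \sum_(i < (size p).+1) (p * 'X)`_i *: iter i T x -
    \sum_(i < (size p).+1) (p * c%:P)`_i *: iter i T x.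
  by rewrite -sumrB; apply: eq_bigr => i _; rewrite mulrBr coefB scalerBl.
rewrite big_ord_recl /= coefMX /= scale0r add0r.
rewrite [X in _ - X]big_ord_recr /= coefMC nth_default // mul0r scale0r addr0.
rewrite -sumrB; apply: eq_bigr => i _.
have ilin := linear_iter i Tlin.
rewrite coefMX /= coefMC /shift (linB ilin) (linZ ilin) scalerBr scalerA.
by rewrite -iterS iterSr.
Qed.

Hypothesis closedK : forall p : {poly K}, size p != 1%N -> exists c, root p c.

(** Roots are split off one at a time: if p = q (X - c), then q annihilates [(T - c) x], and
    decomposability passes from there back to [x]. *)
Lemma decomposable_poly (p : {poly K}) x :
  p != 0 -> poly_apply p x = 0 -> decomposable x.
Proof.
move: {2}(size p) (leqnn (size p)) => n; elim: n p x => [|n IH] p x.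
  by rewrite leqn0 size_poly_eq0 => /eqP-> /eqP.
move=> pn p0; have [s1|s1] := eqVneq (size p) 1%N.
  rewrite /poly_apply s1 big_ord1 /= => /eqP; rewrite scaler_eq0.
  have : lead_coef p != 0 by rewrite lead_coef_eq0.
  rewrite lead_coefE s1 /= => /negPf-> /= /eqP->.
  exact: subspace_decomposable.1.
have [c rc] := closedK s1; have [q eq] := factor_theorem _ _ rc.
have q0 : q != 0 by apply: contra_neq p0 => q0; rewrite eq q0 mul0r.
rewrite eq poly_apply_mulXsubC => qx; apply: (@decomposable_shift c).
apply: (IH q) => //; move: pn.
by rewrite eq size_Mmonic ?monicXsubC // size_XsubC addn2.
Qed.

(** The [n.+1] vectors [T^i x] lie in the span of [n] vectors. A nonzero row in the left kernel of
    their coefficient matrix lists the coefficients of a polynomial that annihilates [x]. *)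
Lemma decomposable_bounded P x : stable T P -> bounded_dim P -> P x ->
  decomposable x.
Proof.
move=> sP [n [e he]] Px.
have Pi i : P (iter i T x) by elim: i => // i IH; rewrite iterS; exact: sP.2.
have /boolp.choice[a ea] : forall i, exists a : 'I_n -> K,
  iter i T x = \sum_(j < n) a j *: e j by move=> i; exact: he.
pose C := \matrix_(i < n.+1, j < n) a i j.
have : kermx C != 0.
  by rewrite -mxrank_eq0 mxrank_ker subn_eq0 -ltnNge ltnS rank_leq_col.
case/rowV0Pn => v /sub_kermxP vC v0.
apply: (@decomposable_poly (\poly_(i < n.+1) v 0 (inord i))).
  apply: contra_neq v0 => p0; apply/rowP => i; rewrite mxE.
  have := congr1 (fun p : {poly K} => p`_i) p0.
  by rewrite coef_poly ltn_ord coef0 inord_val.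
rewrite (@poly_applyE _ n.+1) ?size_poly //.
transitivity (\sum_(i < n.+1) \sum_(j < n) (v 0 i * C i j) *: e j).
  apply: eq_bigr => i _; rewrite coef_poly ltn_ord inord_val ea scaler_sumr.
  by apply: eq_bigr => j _; rewrite scalerA mxE.
rewrite exchange_big big1 //= => j _; rewrite -scaler_suml.
have := congr1 (fun M : 'rV_n => M 0 j) vC; rewrite !mxE => ->.
by rewrite scale0r.
Qed.

End Decomposition.

Section Projections.
Variables (K : fieldType) (X : lmodType K) (T : X -> X).
Hypothesis Tlin : linear T.
Implicit Types (P : set X) (h c : K).

(* The component of [x] of generalized eigenvalue [h]; [0] if [x] has no
   decomposition. *)
Definition proj h x : X :=
  if pselect (exists y, exists s f, decomp T x s f /\ y = f h) is left e
  then projT1 (cid e) else 0.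

Lemma projE h x s f : decomp T x s f -> proj h x = f h.
Proof.
move=> dx; rewrite /proj; case: pselect => [e|[]]; last by exists (f h), s, f.
by case: cid => /= _ [s' [g [dg ->]]]; exact: (decomp_unique Tlin dg dx).
Qed.

Hypothesis dec : forall x, decomposable T x.

Lemma proj_linear h : linear (proj h).
Proof.
move=> a x y; have [s [f df]] := dec x; have [s' [g dg]] := dec y.
by rewrite (projE h df) (projE h dg) (projE h (decomp_lin Tlin a df dg)).
Qed.

Lemma proj_geig h x : geig T h (proj h x).
Proof. by have [s [f df]] := dec x; rewrite (projE h df); case: df. Qed.

Lemma proj_id h x : geig T h x -> proj h x = x.
Proof. by move=> hx; rewrite (projE h (decomp_geig Tlin hx)) eqxx. Qed.

Lemma proj_neq h h' x : h' != h -> geig T h x -> proj h' x = 0.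
Proof. by move=> hh hx; rewrite (projE h' (decomp_geig Tlin hx)) (negPf hh). Qed.

Lemma proj_decomp x : exists s, decomp T x s (proj^~ x).
Proof.
have [s [f df]] := dec x; exists s; suff -> : proj^~ x = f by [].
by apply/funext => h; exact: projE df.
Qed.

Lemma proj_stable P h x : stable T P -> P x -> P (proj h x).
Proof.
by move=> sP Px; have [s dx] := proj_decomp x; exact: (decomp_stable Tlin sP Px dx).
Qed.

Lemma proj_move (S : X -> X) c h x : linear S ->
  (forall y, T (S y) = S (T y) + c *: S y) -> proj (h + c) (S x) = S (proj h x).
Proof.
move=> Slin TS; have [s [_ xh _ ex]] := proj_decomp x.
have key g : proj (h + c) (S (proj g x)) = S (proj h (proj g x)).
  have gx := geig_move Slin TS (xh g).
  have [->|hg] := eqVneq h g; first by rewrite (proj_id gx) (proj_id (xh g)).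
  rewrite (proj_neq hg (xh g)) (lin0 Slin); apply: (proj_neq _ gx).
  by rewrite (inj_eq (addIr c)).
rewrite {1 2}ex (lin_sum Slin) !(lin_sum (proj_linear _)) (lin_sum Slin).
by apply: eq_bigr => g _; exact: key.
Qed.

Lemma proj_comm (S : X -> X) h x : linear S ->
  (forall y, T (S y) = S (T y)) -> proj h (S x) = S (proj h x).
Proof.
move=> Slin TS; rewrite -[X in proj X (S x)](addr0 h); apply: proj_move => // y.
by rewrite TS scale0r addr0.
Qed.

Lemma subset_geigs P : subspace P -> (forall h, geig T h `<=` P) -> forall x, P x.
Proof.
move=> sP hP x; have [s [_ xh _ ->]] := proj_decomp x.
by apply: subspace_sum => // h _ _; exact: hP (xh h).
Qed.

End Projections.

(** As [R] is the sum of the commuting maps [T - h] and [S - g], one application of [R] turns [y]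
    into a term with a smaller exponent for the first map plus a term with a smaller exponent for
    the second. *)
Lemma geig_add (K : fieldType) (X : lmodType K) (T S : X -> X) (h g : K) x :
  linear T -> linear S -> (forall y, T (S y) = S (T y)) ->
  geig T h x -> geig S g x -> geig (fun y => T y + S y) (h + g) x.
Proof.
move=> Tlin Slin TS [k hk] [m gm].
pose R := shift (fun y => T y + S y) (h + g).
have Rlin : linear R.
  apply: shift_linear => a y z; rewrite Tlin Slin scalerDr addrACA; congr (_ + _).
have RE y : R y = shift T h y + shift S g y.
  by rewrite /R /shift scalerDl opprD addrACA.
have shTS y : shift T h (shift S g y) = shift S g (shift T h y).
  rewrite /shift !(linB Tlin) !(linB Slin) !(linZ Tlin) !(linZ Slin) TS !scalerBr !opprB !scalerA.
  by rewrite [h * g]mulrC addrACA [RHS]addrACA [X in _ + X]addrC.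
suff : forall N k m y, (k + m <= N)%N -> iter k (shift T h) y = 0 ->
    iter m (shift S g) y = 0 -> iter N R y = 0.
  by move=> /(_ (k + m)%N k m x (leqnn _) hk gm) e; exists (k + m)%N.
elim=> [|N IH] {x hk gm m} {}k m y.
  by rewrite leqn0 addn_eq0 => /andP[/eqP-> _].
have iT j := linear_iter j (shift_linear Tlin h).
have iS j := linear_iter j (shift_linear Slin g).
case: k => [|k]; first by move=> _ /= -> _; exact: lin0 (linear_iter N.+1 Rlin).
case: m => [|m]; first by move=> _ _ /= ->; exact: lin0 (linear_iter N.+1 Rlin).
move=> kmN ky my; rewrite iterSr RE (linD (linear_iter N Rlin)).
rewrite (IH k m.+1) ?(IH k.+1 m) ?addr0 //; try lia.
- have -> : iter k.+1 (shift T h) (shift S g y) = shift S g (iter k.+1 (shift T h) y).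
    by elim: (k.+1) => // j ih; rewrite !iterS ih shTS.
  by rewrite ky (lin0 (shift_linear Slin g)).
- by rewrite -iterSr.
- by rewrite -iterSr.
- have -> : iter m.+1 (shift S g) (shift T h y) = shift T h (iter m.+1 (shift S g) y).
    by elim: (m.+1) => // j ih; rewrite !iterS ih shTS.
  by rewrite my (lin0 (shift_linear Tlin h)).
Qed.

Lemma fsum_supp (V : nmodType) (I : choiceType) (r : seq I) (F : I -> V) :
  uniq r -> (forall i, i \notin r -> F i = 0) ->
  \sum_(i \in [set: I]) F i = \sum_(i <- r) F i.
Proof.
move=> ur F0; rewrite (fsbigE r) //; last by move=> i _; exact: F0.
by apply: eq_bigl => i; rewrite in_setT.
Qed.

(** * Consequences of the Jacobi identity *)

Section Binomials.
Variable K : numFieldType.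

Lemma binz0 (m : int) : binz K m 0 = 1.
Proof. by rewrite /binz big_ord0 fact0 divr1. Qed.

Lemma binzS (m : int) i : binz K m i.+1 = binz K m i * (m%:~R - i%:R) / i.+1%:R.
Proof.
rewrite /binz big_ord_recr /= factS mulnC natrM invfM.
by rewrite -!mulrA; congr (_ * _); rewrite mulrCA.
Qed.

Lemma binz_0S i : binz K 0 i.+1 = 0.
Proof. by elim: i => [|i IH]; rewrite binzS ?IH ?mul0r // subrr mulr0 mul0r. Qed.

Lemma binz1 : binz K 1 1 = 1.
Proof. by rewrite binzS binz0 subr0 mulr1 divr1. Qed.

Lemma binz_1SS i : binz K 1 i.+2 = 0.
Proof. by elim: i => [|i IH]; rewrite binzS ?IH ?mul0r // subrr mulr0 mul0r. Qed.

Lemma sign_binzN1 i : (-1) ^+ i * binz K (-1) i = 1.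
Proof.
elim: i => [|i IH]; first by rewrite binz0 mulr1.
rewrite binzS exprS -[RHS]IH.
have i0 : i.+1%:R != 0 :> K by rewrite pnatr_eq0.
have -> : (-1)%:~R - i%:R = - i.+1%:R :> K by rewrite -natr1 opprD addrC mulrN1z.
by move: (i.+1%:R) i0 => x x0; field.
Qed.

Lemma sign_binzN2 i : (-1) ^+ i * binz K (-2) i = i.+1%:R.
Proof.
elim: i => [|i IH]; first by rewrite binz0 mulr1.
have -> : i.+2%:R = i.+1%:R * (i.+2%:R / i.+1%:R) :> K.
  by rewrite mulrC divfK // pnatr_eq0.
rewrite binzS exprS -[X in _ = X * _]IH.
have i0 : i.+1%:R != 0 :> K by rewrite pnatr_eq0.
have -> : (-2)%:~R - i%:R = - i.+2%:R :> K.
  by rewrite mulrNz -opprD -[i.+2]add2n natrD.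
by move: (i.+1%:R : K) (i.+2%:R : K) i0 => x y x0; field.
Qed.

End Binomials.

Section WeakModules.
Variables (K : numFieldType) (V : voa_data K) (W : mod_data V).
Hypothesis wW : is_weak_module W.
Implicit Types (u v : V) (w : W) (m n l k : int).

Lemma act_linear v n : linear (act v n : W -> W).
Proof. by have [/(_ n)[_ h] _ _ _] := wW => a x y; exact: (h a v x y). Qed.

Lemma act_linear_l n w : linear (fun v => act v n w).
Proof. by have [/(_ n)[h _] _ _ _] := wW => a x y; exact: (h a x y w). Qed.

Lemma Lop_linear n : linear (Lop n : W -> W).
Proof. exact: act_linear. Qed.

Lemma act_vacuum n w : act (vacuum V) n w = if n == -1 then w else 0.
Proof. by have [_ _ + _] := wW; exact. Qed.

(** The Jacobi identity at [l = 0], where the binomials of 0 leave only [i = 0] on its right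
    side. *)
Lemma commutator u v m n w :
  act u m (act v n w) - act v n (act u m w) =
  \sum_(i \in [set: nat]) binz K m i *: act (nprod u i v) (m + n - i%:Z) w.
Proof.
have [_ _ _ /(_ u v w 0 m n)] := wW.
under eq_fsbigr do rewrite add0r.
move=> ->; rewrite (@fsum_supp _ _ [:: 0%N]) //; last first.
  by case=> [//|i] _; rewrite binz_0S mulr0 scale0r.
rewrite big_seq1 binz0 mulr1 scale1r.
by rewrite !addr0 expr0z scale1r.
Qed.

(** The Jacobi identity at [m = 0], where only [i = 0] is left on its left side. *)
Lemma iterate u v l n w :
  act (nprod u l v) n w = \sum_(i \in [set: nat]) ((-1) ^+ i * binz K l i) *:
    (act u (l - i%:Z) (act v (n + i%:Z) w)
     - (-1) ^ l *: act v (n + l - i%:Z) (act u i%:Z w)).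
Proof.
have [_ _ _ /(_ u v w l 0 n)] := wW.
rewrite (@fsum_supp _ _ [:: 0%N]) //; last first.
  by case=> [//|i] _; rewrite binz_0S scale0r.
rewrite big_seq1 binz0 scale1r addr0 add0r addr0 => ->.
by apply: eq_fsbigr => i _; rewrite !add0r.
Qed.

(** This gives the L(-1)-derivative property on modules, by the iterate formula for v_(-2) 1. Vacuum
    modes vanish except at -1, which leaves [i = -n - 1] if [n < 0], [i = n - 1] if [n > 0], and
    nothing if [n = 0]. *)
Lemma act_creation v n w :
  act (nprod v (-2) (vacuum V)) n w = (- n)%:~R *: act v (n - 1) w.
Proof.
have vlin k := act_linear v k.
have sgn2 : (-1) ^ (-2) = 1 :> K by rewrite -[(-1) ^ _]/(((-1) ^+ 2)^-1) sqrrN expr1n invr1.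
rewrite iterate; under eq_fsbigr => i _ do
  rewrite sign_binzN2 !act_vacuum sgn2 scale1r.
have [n0|n0|->] := ltgtP n 0; last first.
- rewrite (@fsum_supp _ _ [::]) // ?big_nil ?oppr0 ?scale0r // => i _.
  rewrite !ifF ?(lin0 (vlin _)) ?subrr ?scaler0 //; lia.
- rewrite (@fsum_supp _ _ [:: absz (n - 1)]) // => [|i].
    rewrite big_seq1 ifF ?ifT; try lia.
    rewrite (lin0 (vlin _)) sub0r (_ : (absz (n - 1))%:Z = n - 1); last by lia.
    rewrite scalerN -scaleNr; congr (_ *: _).
    rewrite -[_%:R]/(_%:Z%:~R) -mulrNz; congr (_%:~R); lia.
  rewrite inE => ?; rewrite !ifF ?(lin0 (vlin _)) ?subrr ?scaler0 //; lia.
- rewrite (@fsum_supp _ _ [:: absz (n + 1)]) // => [|i].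
    rewrite big_seq1 ifT ?ifF; try lia.
    rewrite subr0; congr (_ *: act _ _ _); last by lia.
    rewrite -[_%:R]/(_%:Z%:~R); congr (_%:~R); lia.
  rewrite inE => ?; rewrite !ifF ?(lin0 (vlin _)) ?subrr ?scaler0 //; lia.
Qed.

Hypothesis hV : is_voa V.

Lemma Lm1_creation v : Lop (W := adjoint V) (-1) v = nprod v (-2) (vacuum V).
Proof.
have [[_ cr] _ der _ _] := hV.
have := der v (vacuum V) (-1); rewrite (cr _).1 /= opprK scale1r => ->.
by congr nprod.
Qed.

Lemma act_Lm1 v n w :
  act (Lop (W := adjoint V) (-1) v) n w = (- n)%:~R *: act v (n - 1) w.
Proof. by rewrite Lm1_creation act_creation. Qed.

(** Only [i = 0] and [i = 1] survive in the commutator of omega_1 with v_n: they give (L(-1)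
    v)_(n+1) = -(n + 1) v_n and (L(0) v)_n = k v_n. *)
Lemma Lop0_act v k n w : weight_space k v ->
  Lop 0 (act v n w) = act v n (Lop 0 w) + (k - n - 1)%:~R *: act v n w.
Proof.
move=> wv; rewrite /Lop add0r.
have := commutator (conformal V) v 1 n w.
rewrite (@fsum_supp _ _ [:: 0%N; 1%N]) //; last first.
  by case=> [|[|i]] //= _; rewrite binz_1SS scale0r.
rewrite !big_cons big_nil addr0 binz0 binz1 !scale1r.
rewrite -[nprod _ 0 v]/(Lop (W := adjoint V) (-1) v) act_Lm1.
rewrite -[nprod _ 1 v]/(Lop (W := adjoint V) 0 v) wv (linZ (act_linear_l _ _)).
rewrite addr0 (_ : 1 + n - 1%N%:Z = n); last by lia.
rewrite -scalerDl -rmorphD => /(canRL (subrK _)) ->.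
rewrite addrC; congr (_ + _%:~R *: _); lia.
Qed.

End WeakModules.

Section VOAs.
Variables (K : numFieldType) (V : voa_data K).
Hypotheses (hV : is_voa V) (gV : N_graded V).

Lemma adjoint_weak : is_weak_module (adjoint V).
Proof. by case: hV => -[]. Qed.

Lemma weight_Lm1 (k : int) (v : V) : weight_space k v ->
  weight_space (k + 1) (Lop (W := adjoint V) (-1) v).
Proof.
have [_ [c vir] _ _ _] := hV => kv.
have := vir 0 (-1) v.
rewrite [0 + -1 == 0](_ : _ = false) // scale0r addr0 (_ : (0 - (-1))%:~R = 1 :> K) // scale1r.
rewrite (_ : 0 + -1 = -1 :> int) // kv.
rewrite (linZ (Lop_linear adjoint_weak _)) => /(canRL (subrK _)) e.
by apply: (etrans e); rewrite intrD scalerDl scale1r addrC.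
Qed.

Lemma weight_vacuum : weight_space 0 (vacuum V).
Proof.
have [[_ cr] _ _ _ _] := hV.
by rewrite /weight_space /= scale0r; exact: (cr (conformal V)).2.
Qed.

Lemma weight_induction (P : set V) : subspace P ->
  (forall k : int, 0 <= k -> weight_space k `<=` P) -> forall v, P v.
Proof.
have [_ _ _ [sp _] _] := hV => sP hP v.
have [s [f [_ kf ->]]] := sp v; apply: subspace_sum => // k _ _.
have [k0|k0] := leP 0 k; first exact: hP (kf k).
by have := kf k; rewrite gV // => ->; exact: sP.1.
Qed.

(** v_(-1-j) is a scalar multiple of (L(-1)^j v)_(-1), and L(-1)^j v has weight k + j. A vector of
    weight 0 thus contributes as soon as j > 0, and vectors of negative weight are 0. *)
Lemma C1_mode (W : mod_data V) (k : int) (v : V) (j : nat) (w : W) :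
  is_weak_module W -> weight_space k v -> (0 < k) || (0 < j)%N ->
  C1_space (W := W) (act v (-1 - j%:Z) w).
Proof.
move=> wW; elim: j k v => [|j IH] k v kv kj.
  by apply: sub_span; exists v, k, w; split=> //; move: kj; rewrite orbF.
have [k0|k0] := leP 0 k; last first.
  move: kv; rewrite gV // => ->; rewrite (lin0 (act_linear_l wW _ _)).
  exact: (subspace_span _).1.
have -> : act v (-1 - j.+1%:Z) w =
    j.+1%:R^-1 *: act (Lop (W := adjoint V) (-1) v) (-1 - j%:Z) w.
  rewrite (act_Lm1 wW hV) scalerA.
  rewrite (_ : - (-1 - j%:Z) = j.+1); last by lia.
  by rewrite mulVf ?pnatr_eq0 // scale1r; congr act; lia.
apply: subspaceZ; first exact: subspace_span.
by apply: (IH _ _ (weight_Lm1 kv)); apply/orP; left; lia.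
Qed.

End VOAs.

Lemma direct_sum_geig (K : fieldType) (X : lmodType K) (T : X -> X) : linear T ->
  direct_sum (geig T) <-> forall x, decomposable T x.
Proof.
move=> Tlin; split=> [[sp _] x|dec].
  have [s [f [us fh ->]]] := sp x.
  exists s, (fun h => if h \in s then f h else 0); split=> //.
  - by move=> h; case: ifP => // _; exact: (subspace_geig Tlin h).1.
  - by move=> h /negPf->.
  - by rewrite big_seq [RHS]big_seq; apply: eq_bigr => h ->.
split=> [x|s f us fh f0 h hs].
  by have [s [f [us fh _ ex]]] := dec x; exists s, f.
have := @stable_components _ _ _ Tlin [set 0] s f (stable0 Tlin) us fh.
by move=> /(_ f0 h hs).
Qed.

Lemma gr_moduleP (K : numFieldType) (V : voa_data K) (W : mod_data V) :
  is_gr_module W <->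
  [/\ is_weak_module W, forall w : W, decomposable (Lop 0) w,
      forall h, bounded_dim (geig (@Lop K V W 0) h) &
      forall h, exists N : int, forall n : int, n <= N ->
        geig (@Lop K V W 0) (h + n%:~R) `<=` [set 0]].
Proof.
split=> [[[wW /(direct_sum_geig (Lop_linear wW 0)) dec] gr]|[wW dec fin low]].
  split=> // h; first exact: finite_dimensional_bounded (gr h).1.
  by have [_ [N hN]] := gr h; exists N => n /hN; rewrite /geig /= => <-.
have Llin := Lop_linear wW 0.
split; first by split=> //; apply/(direct_sum_geig Llin).
move=> h; split.
  by apply: bounded_dim_finite (fin h); exact: subspace_geig.
have [N hN] := low h; exists N => n /hN => sub0.
apply/seteqP; split=> [x /sub0 //|_ ->]; exact: (subspace_geig Llin _).1.
Qed.

(** * Transport along module maps *)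

Section Morphisms.
Variables (K : numFieldType) (V : voa_data K) (W X : mod_data V) (phi : W -> X).
Hypotheses (plin : linear phi) (pinj : injective phi).
Hypothesis pact : forall v n w, phi (act v n w) = act v n (phi w).

Lemma weak_module_inj : is_weak_module X -> is_weak_module W.
Proof.
move=> wX; have [_ tr vac jac] := wX; split.
- move=> n; split=> [a v v' w|a v w w']; apply: pinj; rewrite plin !pact.
    exact: act_linear_l.
  by rewrite plin act_linear.
- move=> v w; have [N hN] := tr v (phi w); exists N => n /hN e.
  by apply: pinj; rewrite pact e (lin0 plin).
- by move=> n w; apply: pinj; rewrite pact vac; case: ifP => //; rewrite (lin0 plin).
- move=> u v w l m n; apply: pinj; rewrite !(lin_fsum plin) //.
  under eq_fsbigr do rewrite (linZ plin) pact.
  rewrite jac; apply: eq_fsbigr => i _.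
  by rewrite (linZ plin) (linB plin) (linZ plin) !pact.
Qed.

Lemma geig_inj h w :
  geig (@Lop K V W 0) h w <-> geig (@Lop K V X 0) h (phi w).
Proof.
have e k : phi (iter k (shift (@Lop K V W 0) h) w) =
    iter k (shift (@Lop K V X 0) h) (phi w).
  elim: k => // k IH; rewrite !iterS -IH /shift (linB plin) (linZ plin).
  by rewrite /Lop pact.
split=> -[k hk]; exists k; first by rewrite -e hk (lin0 plin).
by apply: pinj; rewrite e hk (lin0 plin).
Qed.

(** [X] need not be grading-restricted: over U alone, a U (x) V-module has in general
    infinite-dimensional weight spaces. The finiteness conditions therefore concern the image of
    [phi] only. *)
Lemma gr_module_inj : is_weak_module X ->
  (forall w, decomposable (@Lop K V X 0) (phi w)) ->
  (forall h, bounded_dim (geig (@Lop K V X 0) h `&` range phi)) ->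
  (forall h, exists N : int, forall (n : int) w, n <= N ->
     geig (@Lop K V X 0) (h + n%:~R) (phi w) -> w = 0) ->
  is_gr_module W.
Proof.
move=> wX dec fin low; have wW := weak_module_inj wX.
have LX := Lop_linear wX 0; have LW := Lop_linear wW 0.
have srange : subspace (range phi).
  by apply: subspace_image => //; split.
apply/gr_moduleP; split=> //.
- move=> w; have [s [f dw]] := dec w; have [us fh f0 ew] := dw.
  have /boolp.choice[g gE] : forall h, exists y, phi y = f h.
    move=> h; have [||y _ <-] := @decomp_stable _ _ _ LX (range phi) (phi w) s f _ _ dw h.
    - by split=> // _ [y _ <-]; exists (Lop 0 y) => //; rewrite /Lop pact.
    - by exists w.
    - by exists y.
  exists s, g; split=> //.
  - by move=> h; apply/geig_inj; rewrite gE.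
  - by move=> h /f0 e; apply: pinj; rewrite gE e (lin0 plin).
  - apply: pinj; rewrite ew (lin_sum plin); apply: eq_bigr => h _; by rewrite gE.
- move=> h.
  have [n [e [he span_e]]] : finite_dimensional (geig (@Lop K V X 0) h `&` range phi).
    apply: bounded_dim_finite (fin h); apply: subspaceI => //; exact: subspace_geig.
  have /boolp.choice[g gE] : forall i, exists y, phi y = e i.
    by move=> i; have [_ [y _ <-]] := he i; exists y.
  exists n, g => w /geig_inj hw.
  have [|a ea] := span_e (phi w); first by split=> //; exists w.
  exists a; apply: pinj; rewrite ea (lin_sum plin); apply: eq_bigr => i _.
  by rewrite (linZ plin) gE.
- move=> h; have [N hN] := low h; exists N => n nN w /geig_inj.
  exact: hN.
Qed.

Lemma C1_category_iso : (forall x, exists w, phi w = x) ->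
  C1_category X -> C1_category W.
Proof.
move=> psurj [/gr_moduleP[wX dec fin low] [n [e he]]]; split.
  apply: gr_module_inj => //.
    by move=> h; apply: bounded_dim_mono (fin h) => x [].
  move=> h; have [N hN] := low h; exists N => m w /hN h0 /h0 /= e0.
  by apply: pinj; rewrite e0 (lin0 plin).
have /boolp.choice[g gE] : forall i, exists y, phi y = e i.
  by move=> i; have [y <-] := psurj (e i); exists y.
exists n, g => w; have [a ha] := he (phi w); exists a.
have : (C1_space (W := X)) `<=` phi @` (C1_space (W := W)).
  apply: span_min; first by apply: subspace_image => //; exact: subspace_span.
  move=> _ [v [k [x [kv k0 ->]]]]; have [y <-] := psurj x.
  by exists (act v (-1) y); rewrite ?pact //; apply: sub_span; exists v, k, y.
move=> /(_ _ ha)[y Cy ey].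
suff -> : w - \sum_(i < n) a i *: g i = y by [].
apply: pinj; rewrite ey (linB plin) (lin_sum plin); congr (_ - _).
by apply: eq_bigr => i _; rewrite (linZ plin) gE.
Qed.

End Morphisms.

Lemma subspace_sub (K : numFieldType) (V : voa_data K) (W : mod_data V)
  (S : submodule W) : subspace (sub_set S).
Proof. by split; [exact: sub0 | exact: subP]. Qed.

Section SubmoduleElements.
Variables (K : numFieldType) (V : voa_data K) (W : mod_data V).
Implicit Types (S : submodule W).

Lemma val_linear S : linear (fun x : sub_mod S => val x : W).
Proof. by []. Qed.

Lemma val_inj_sub S : injective (fun x : sub_mod S => val x : W).
Proof. exact: val_inj. Qed.

Lemma valP_sub S (x : sub_mod S) : sub_set S (val x).
Proof. exact/asboolP/(valP x). Qed.

Definition in_sub S (x : W) (Sx : sub_set S x) : sub_mod S :=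
  exist _ x (asboolT Sx).

Lemma generated_mem (x : W) : sub_set (generated x) x.
Proof. by move=> S. Qed.

Lemma generated_min S (x : W) : sub_set S x -> generated_set x `<=` sub_set S.
Proof. by move=> Sx y; exact. Qed.

End SubmoduleElements.

Section SubmoduleTransport.
Variables (K : numFieldType) (V : voa_data K) (W : mod_data V).
Implicit Types (S G : submodule W).

Lemma pullback_subspace G S : subspace [set x : sub_mod G | sub_set S (val x)].
Proof.
split; first exact: sub0.
by move=> a x y /= Sx Sy; exact: subP.
Qed.

Definition pullback G S : submodule (sub_mod G) :=
  @Submodule K V (sub_mod G) [set x | sub_set S (val x)]
    (pullback_subspace G S).1 (pullback_subspace G S).2
    (fun v n x Sx => sub_act v n Sx).

Lemma pushforward_act G (S : submodule (sub_mod G)) v n x :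
  [set val y | y in sub_set S] x -> [set val y | y in sub_set S] (act v n x).
Proof. by move=> [y Sy <-]; exists (act v n y) => //; exact: sub_act. Qed.

Lemma pushforward_subspace G (S : submodule (sub_mod G)) :
  subspace [set val y | y in sub_set S].
Proof. exact: (subspace_image (val_linear (S := G)) (subspace_sub S)). Qed.

Definition pushforward G (S : submodule (sub_mod G)) : submodule W :=
  @Submodule K V W [set val y | y in sub_set S]
    (pushforward_subspace S).1 (pushforward_subspace S).2
    (@pushforward_act G S).

(** The closure hypothesis speaks of submodules of [sub_mod G], so [generated x] is identified with
    the submodule of [sub_mod G] generated by [x]; pulling back and pushing forward submodules shows
    that the two have the same elements. *)
Lemma C1_category_generated G (x : W) :
  closed_under_submodules (C1_category (V := V)) ->
  C1_category (sub_mod G) -> sub_set G x -> C1_category (sub_mod (generated x)).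
Proof.
move=> closed CG Gx; pose y := in_sub Gx.
have inG (z : sub_mod (generated x)) : sub_set G (val z).
  exact: (generated_min Gx (valP_sub z)).
have inS (z : sub_mod (generated x)) : sub_set (generated y) (in_sub (inG z)).
  move=> S Sy; have := valP_sub z => /(_ (pushforward S)) /=.
  case; first by exists y.
  by move=> z' Sz' ez'; suff -> : in_sub (inG z) = z' by []; apply: val_inj.
refine (@C1_category_iso K V (sub_mod (generated x)) (sub_mod (generated y)) (fun z => in_sub (inS z)) _ _ _ _ _).
- by move=> a z z'; do 2 apply: val_inj.
- by move=> z z' /(congr1 (fun t => val (val t))) /= ?; apply: val_inj.
- by move=> v n z; do 2 apply: val_inj.
- move=> t.
  have xt : sub_set (generated x) (val (val t)).
    by move=> S Sx; have := valP_sub t => /(_ (pullback G S)) /=; exact.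
  by exists (in_sub xt); do 2 apply: val_inj.
- exact: closed.
Qed.

End SubmoduleTransport.

(** * Composition series *)

Section SubmoduleOperations.
Variables (K : numFieldType) (V : voa_data K) (W : mod_data V).
Hypothesis wW : is_weak_module W.
Implicit Types (S T : submodule W).

Definition build_sub (A : set W) (sA : subspace A)
    (actA : forall v n x, A x -> A (act v n x)) : submodule W :=
  @Submodule K V W A sA.1 sA.2 actA.

Lemma sumset_act S T v n x :
  sumset (sub_set S) (sub_set T) x -> sumset (sub_set S) (sub_set T) (act v n x).
Proof.
move=> [y [z [Sy Tz ->]]]; exists (act v n y), (act v n z).
by split; [exact: sub_act | exact: sub_act | rewrite (linD (act_linear wW v n))].
Qed.

Definition add_sub S T : submodule W :=
  build_sub (subspace_sumset (subspace_sub S) (subspace_sub T)) (@sumset_act S T).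

Lemma setI_act S T v n x :
  (sub_set S `&` sub_set T) x -> (sub_set S `&` sub_set T) (act v n x).
Proof. by move=> [Sx Tx]; split; exact: sub_act. Qed.

Definition cap_sub S T : submodule W :=
  build_sub (subspaceI (subspace_sub S) (subspace_sub T)) (@setI_act S T).

Definition null_sub : submodule W :=
  @build_sub [set 0] (stable0 (T := id) (fun _ _ _ => erefl)).1
    (fun v n x (x0 : x = 0) => etrans (congr1 (act v n) x0) (lin0 (act_linear wW v n))).

Definition full_sub : submodule W :=
  @build_sub [set: W] (conj I (fun _ _ _ _ _ => I)) (fun _ _ _ _ => I).

Definition simple_step (A B : set W) : Prop :=
  A `<` B /\ forall N : submodule W, A `<=` N -> N `<=` B -> N = A :> set W \/ N = B :> set W.

Definition composition_chain (A B : set W) : Prop :=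
  exists (n : nat) (F : nat -> submodule W),
    [/\ F 0%N = A :> set W, F n = B :> set W &
      forall i, (i < n)%N -> simple_step (F i) (F i.+1)].

Lemma composition_chain_trans (A B C : set W) :
  composition_chain A B -> composition_chain B C -> composition_chain A C.
Proof.
move=> [n [F [F0 Fn hF]]] [m [G [G0 Gm hG]]].
exists (n + m)%N, (fun i => if (i < n)%N then F i else G (i - n)%N).
have nE i : (n <= i)%N -> (if (i < n)%N then F i else G (i - n)%N) = G (i - n)%N.
  by move=> ni; rewrite ltnNge ni.
split.
- case: n Fn {hF nE} => [|n] //= Fn; by rewrite G0 -Fn.
- by rewrite nE ?leq_addr // addKn.
move=> i inm; have [iN|iN] := ltnP i n; last first.
  by rewrite nE ?leqW // subSn //; apply: hG; lia.
have := hF _ iN; case: (ltnP i.+1 n) => // ni.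
have -> : i.+1 = n by lia.
by rewrite subnn G0 Fn.
Qed.

(* A bounded strictly monotone function on submodules bounds the length of
   chains, so a maximal chain exists. *)
Lemma finite_length_of_rank (n : nat) (r : submodule W -> nat) :
  (forall S, (r S <= n)%N) ->
  (forall S T, S `<=` T -> (r S <= r T)%N /\ (r S = r T -> T `<=` S)) ->
  finite_length W.
Proof.
move=> rn mono.
suff key k S T : S `<=` T -> (r T - r S <= k)%N -> composition_chain S T.
  have [m [F hF]] : composition_chain null_sub full_sub.
    by apply: (key n) => //; exact: leq_trans (leq_subr _ _) (rn _).
  by exists m, F.
elim: k S T => [|k IH] S T ST rST.
  have [rle req] := mono _ _ ST; exists 0%N, (fun=> S); split=> //.
  by apply/seteqP; split=> //; apply: req; lia.
have [TS|TS] := pselect (T `<=` S).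
  by exists 0%N, (fun=> S); split=> //; apply/seteqP.
have [[N [SN NT nNS nTN]]|no] := pselect (exists N : submodule W,
    [/\ S `<=` N, N `<=` T, ~ N `<=` S & ~ T `<=` N]).
  have [le1 eq1] := mono _ _ SN; have [le2 eq2] := mono _ _ NT.
  have ne1 : r S <> r N by move=> /eq1.
  have ne2 : r N <> r T by move=> /eq2.
  by apply: (@composition_chain_trans _ N); apply: IH => //; lia.
exists 1%N, (fun i => if i == 0%N then S else T); split=> //.
case=> // _ /=; split; first by split.
move=> N SN NT; have [NS|NS] := pselect (N `<=` S); first by left; apply/seteqP.
right; apply/seteqP; split=> //.
by have [//|TN] := pselect (T `<=` N); case: no; exists N.
Qed.

(** [r S] counts the factors that [S] meets, i.e. the [i] for which [S] contains a vector of
    [F i.+1] outside [F i]. If [S] and [T] meet the same factors, simplicity lets a vector of [T] be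
    corrected by vectors of [S] one level at a time. *)
Lemma rank_of_finite_length : finite_length W ->
  exists (n : nat) (r : submodule W -> nat),
    (forall S, (r S <= n)%N) /\
    forall S T, S `<=` T -> (r S <= r T)%N /\ (r S = r T -> T `<=` S).
Proof.
move=> [n [F [F0 Fn hF]]].
pose b S (i : nat) := `[< exists x, [/\ sub_set (F i.+1) x, sub_set S x & ~ sub_set (F i) x] >].
exists n, (fun S => \sum_(i < n) b S i)%N; split=> [S|S T ST].
  rewrite -[X in (_ <= X)%N]card_ord -sum1_card; apply: leq_sum => i _.
  by case: (b S i).
have bST (i : 'I_n) : (b S i <= b T i ?= iff (b S i == b T i))%N.
  split=> //; last by case: (b S i); case: (b T i).
  case: (boolP (b S i)) => // /asboolP[x [Fx Sx nx]].
  by rewrite lt0b; apply/asboolP; exists x; split=> //; exact: ST.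
have [le eqs] := leqif_sum (fun i (_ : true) => bST i).
split=> // /eqP; rewrite eqs => /forallP eqb.
suff key i : (i <= n)%N -> forall x, sub_set T x -> sub_set (F i) x -> sub_set S x.
  by move=> x Tx; apply: (key n) => //; rewrite Fn.
elim: i => [|i IH] iN x Tx Fx.
  by move: Fx; rewrite F0 => ->; exact: sub0.
have [Fix|nFix] := pselect (sub_set (F i) x); first exact: IH (ltnW iN) x Tx Fix.
have [[Fii _] simple] := hF _ iN.
have : b T i by apply/asboolP; exists x.
rewrite -(eqP (implyP (eqb (Ordinal iN)) isT)) => /asboolP[p [Fp Sp np]].
(* [S] meets this factor, so adding its part in [F i.+1] to [F i] gives all of [F i.+1]. *)
have [||e|e] := simple (add_sub (F i) (cap_sub S (F i.+1))) _ _.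
- exact: sumsetl (subspace_sub (cap_sub S (F i.+1))).
- move=> _ [y [z [Fy [_ Fz] ->]]].
  by apply: (subspaceD (subspace_sub (F i.+1))) => //; exact: Fii.
- case: np; rewrite -e; apply: (sumsetr (subspace_sub (F i))).
  by split.
have : sub_set (add_sub (F i) (cap_sub S (F i.+1))) x by rewrite e.
move=> [f [q [Ff [Sq Fq] ex]]].
rewrite ex; apply: (subspaceD (subspace_sub S)) => //.
apply: IH => //; first exact: ltnW.
have -> : f = x - q by rewrite ex addrK.
by apply: (subspaceB (subspace_sub T)) => //; exact: ST.
Qed.

End SubmoduleOperations.

(** * Weights that detect composition factors *)

Section ModuleMaps.
Variables (K : numFieldType) (V : voa_data K).

Definition module_map (N X : mod_data V) (a : N -> X) : Prop :=
  linear a /\ forall v n x, a (act v n x) = act v n (a x).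

Lemma image_sub_act (N X : mod_data V) (a : N -> X) (S : submodule N) v n x :
  module_map a -> (a @` sub_set S) x -> (a @` sub_set S) (act v n x).
Proof.
by move=> [_ aact] [y Sy <-]; exists (act v n y); rewrite ?aact //; exact: sub_act.
Qed.

Definition image_sub (N X : mod_data V) (a : N -> X) (am : module_map a)
    (S : submodule N) : submodule X :=
  build_sub (subspace_image am.1 (subspace_sub S))
    (fun v n x => @image_sub_act N X a S v n x am).

(* [H] collects one weight from each composition factor of [N]: a submodule of
   a sum of homomorphic images of [N] is determined by its vectors of weight in
   [H]. *)
Lemma finite_length_weights (N : mod_data V) :
  is_weak_module N -> finite_length N ->
  (forall x : N, decomposable (Lop 0) x) ->
  exists H : seq K, forall (X : mod_data V) (a : N -> X) (P Q E : submodule X),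
    is_weak_module X -> (forall x : X, decomposable (Lop 0) x) ->
    module_map a -> P `<=` Q ->
    (forall h x, h \in H -> geig (Lop 0) h x -> sub_set Q x -> sub_set P x) ->
    Q `&` E `<=` P -> Q `&` sumset (sub_set E) (range a) `<=` P.
Proof.
move=> wN [n [F [F0 Fn hF]]] decN; have LN := Lop_linear wN 0.
have stF (i : nat) : stable (Lop 0) (sub_set (F i)).
  by split=> [|x Fx]; [exact: subspace_sub | exact: sub_act].
(* [F i.+1] is spanned by the weight components of its vectors, and not all of these lie in [F i];
   [h i] is the weight of one that does not. *)
have /boolp.choice[h hE] : forall i : nat, exists h : K, (i < n)%N ->
    exists x : N, [/\ geig (Lop 0) h x, sub_set (F i.+1) x & ~ sub_set (F i) x].
  move=> i; have [iN|] := boolP (i < n)%N; last by exists 0.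
  have [[_ nF] _] := hF _ iN.
  apply: contrapT => no; apply: nF => x Fx.
  have [s [f dx]] := decN x; have [_ fh _ ->] := dx.
  apply: subspace_sum => [|g _ _]; first exact: subspace_sub.
  apply: contrapT => nFg; apply: no; exists g => _; exists (f g); split=> //.
  exact: (decomp_stable LN (stF i.+1) Fx dx).
exists [seq h i | i <- iota 0 n] => X a P Q E wX decX am PQ PQh QE.
have [alin aact] := am; have LX := Lop_linear wX 0.
suff key i : (i <= n)%N ->
    Q `&` sumset (sub_set E) (a @` sub_set (F i)) `<=` P.
  by have := key n (leqnn n); rewrite Fn.
elim: i => [|i IH] iN.
  move=> x [Qx [e [_ [Ee [y + <-] ex]]]].
  rewrite F0 => y0; apply: QE; split=> //.
  by rewrite ex (y0 : y = 0) (lin0 alin) addr0.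
have [[Fii _] simple] := hF _ iN.
pose EF := add_sub wX E (image_sub am (F i)).
have preim (R : submodule X) : subspace (a @^-1` sub_set (add_sub wX R EF) `&` sub_set (F i.+1)).
  apply: subspaceI; last exact: subspace_sub.
  exact: (subspace_preimage alin (subspace_sub (add_sub wX R EF))).
have preim_act R v m x : (a @^-1` sub_set (add_sub wX R EF) `&` sub_set (F i.+1)) x ->
    (a @^-1` sub_set (add_sub wX R EF) `&` sub_set (F i.+1)) (act v m x).
  move=> [Rx Fx]; split; last exact: sub_act.
  by rewrite /preimage /= aact; exact: (sub_act (s := add_sub wX R EF)).
(* The vectors of [F i.+1] whose image lies in R + E + a(F i). They form a submodule between [F i]
   and [F i.+1], hence equal to one of them, for [R = Q] as for [R = P]. *)
pose G R : submodule N := build_sub (preim R) (@preim_act R).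
have GF R : F i `<=` G R.
  move=> x Fx; split; last exact: Fii.
  apply: (sumsetr (subspace_sub R)); apply: (sumsetr (subspace_sub E)).
  by exists x.
have GFi R : G R `<=` F i.+1 by move=> x [].
move=> q [Qq [e [_ [Ee [f Ff <-] eq]]]].
have [Fif|nFif] := pselect (sub_set (F i) f).
  by apply: (IH (ltnW iN)); split=> //; exists e, (a f); split=> //; exists f.
have GQf : sub_set (G Q) f.
  split=> //; rewrite /preimage /=; exists q, (- e); split=> //; last by rewrite eq addrC addKr.
  by apply: (sumsetl (subspace_sub (image_sub am (F i)))); apply: (subspaceN (subspace_sub E)).
have GQ : G Q = F i.+1 :> set N.
  by have [e1|//] := simple (G Q) (GF Q) (@GFi Q); case: nFif; rewrite -e1.
have [e1|GP] := simple (G P) (GF P) (@GFi P); last first.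
  have : sub_set (G P) f by rewrite GP.
  move=> [[p [_ [Pp [e' [_ [Ee' [f' Ff' <-] ->]]] eaf]] _]].
  rewrite -[q](subrK p); apply: (subspaceD (subspace_sub P)) => //.
  apply: (IH (ltnW iN)); split.
    by apply: (subspaceB (subspace_sub Q)) => //; exact: PQ.
  exists (e + e'), (a f'); split; first exact: (subspaceD (subspace_sub E)).
    by exists f'.
  by rewrite eq eaf addrCA addrAC subrr add0r addrA.
(* In the remaining case [G P = F i] and [G Q = F i.+1]. The weight [h i] part of the equation for
   [a x] replaces [q'] by a vector of [Q] of weight [h i], which lies in [P]; this puts [x] into
   [G P], a contradiction. *)
have [x [xh Fx nFx]] := hE i iN; case: nFx; rewrite -e1; split=> //.
have [[q' [_ [Qq' [e' [_ [Ee' [f' Ff' <-] ->]]] eax]]] _] : sub_set (G Q) x by rewrite GQ.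
pose p := proj (@Lop K V X 0) (h i); have plin := proj_linear LX decX (h i).
have pst R y : sub_set R y -> sub_set R (p y).
  apply: (proj_stable LX decX); split=> [|z Rz]; first exact: subspace_sub.
  exact: sub_act.
have ax : geig (@Lop K V X 0) (h i) (a x).
  have [k hk] := xh; exists k; rewrite -[RHS](lin0 alin) -hk.
  elim: k {hk} => // k ih; rewrite !iterS ih /shift (linB alin) (linZ alin).
  by rewrite /Lop aact.
rewrite /preimage /=; exists (p q'), (p (e' + a f')); split.
- apply: (PQh (h i)); [|exact: proj_geig|exact: pst].
  by apply/mapP; exists i; rewrite // mem_iota.
- apply: (pst EF); exists e', (a f'); split=> //; by exists f'.
- by rewrite -(linD plin) -eax /p (proj_id LX ax).
Qed.

End ModuleMaps.

(** * Sums of generalized eigenspaces *)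

Section EigenvalueSupport.
Variables (K : fieldType) (X : lmodType K) (T : X -> X).
Hypotheses (Tlin : linear T) (dec : forall x, decomposable T x).
Implicit Types (s : seq K).

(** The sum of the generalized eigenspaces for the eigenvalues in [s]. As a vanishing condition it
    is visibly a subspace, stable under maps that commute with [T]. *)
Definition geig_supp s : set X := [set x | forall h, h \notin s -> proj T h x = 0].

Definition proj_supp s x : X := \sum_(h <- undup s) proj T h x.

Lemma subspace_geig_supp s : subspace (geig_supp s).
Proof.
split=> [h _|a x y hx hy h hs]; first exact: lin0 (proj_linear Tlin dec h).
by rewrite (proj_linear Tlin dec) hx // hy // scaler0 addr0.
Qed.

Lemma geig_geig_supp s h x : h \in s -> geig T h x -> geig_supp s x.
Proof.
move=> hs hx g gs; apply: (proj_neq Tlin _ hx).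
by apply: contraNneq gs => ->.
Qed.

Lemma proj_supp_linear s : linear (proj_supp s).
Proof.
move=> a x y; rewrite /proj_supp scaler_sumr -big_split.
by apply: eq_bigr => h _; exact: proj_linear.
Qed.

Lemma proj_supp_mem s x : geig_supp s (proj_supp s x).
Proof.
apply: subspace_sum => [|h + _]; first exact: subspace_geig_supp.
by rewrite mem_undup => hs; apply: geig_geig_supp hs _; exact: proj_geig.
Qed.

Lemma proj_supp_id s x : geig_supp s x -> proj_supp s x = x.
Proof.
move=> sx; have [r [ur _ r0 ex]] := proj_decomp Tlin dec x.
rewrite [RHS]ex.
have us : uniq (undup (s ++ r)) by exact: undup_uniq.
rewrite -(big_supp ur us _ r0) => [|h]; last by rewrite mem_undup mem_cat orbC => ->.
rewrite /proj_supp -(big_supp (undup_uniq s) us) // => h; last first.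
  by rewrite mem_undup => /sx.
by rewrite !mem_undup mem_cat => ->.
Qed.

Lemma geig_supp_exists x : exists s, geig_supp s x.
Proof. by have [s [_ _ h _]] := proj_decomp Tlin dec x; exists s. Qed.

Lemma geig_supp_mono s r : {subset s <= r} -> geig_supp s `<=` geig_supp r.
Proof. by move=> sr x sx h hr; apply: sx; apply: contra hr => /sr. Qed.

Lemma geig_supp_comm (S : X -> X) s x : linear S ->
  (forall y, T (S y) = S (T y)) -> geig_supp s x -> geig_supp s (S x).
Proof.
by move=> Slin TS sx h hs; rewrite (proj_comm Tlin dec) // sx // (lin0 Slin).
Qed.

End EigenvalueSupport.

(** * Commuting actions of two vertex operator algebras *)

Section CommutingPairs.
Variables (K : numFieldType).
Hypothesis closedK : forall p : {poly K}, size p != 1%N -> exists c, root p c.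

(* The data that a C_1-cofinite U (x) V-module [X] induces on its underlying
   space, in a form which is symmetric in U and V. *)
Record C1_pair (U V : voa_data K) (X : lmodType K)
    (aU : U -> int -> X -> X) (aV : V -> int -> X -> X) : Prop := C1Pair {
  pair_voaU : is_voa U;
  pair_voaV : is_voa V;
  pair_gradU : N_graded U;
  pair_gradV : N_graded V;
  pair_weakU : is_weak_module (ModData aU);
  pair_weakV : is_weak_module (ModData aV);
  pair_comm : forall u v m n x, aU u m (aV v n x) = aV v n (aU u m x);
  pair_dec : forall x,
    decomposable (fun x => Lop (W := ModData aU) 0 x + Lop (W := ModData aV) 0 x) x;
  pair_fin : forall h,
    bounded_dim (geig (fun x => Lop (W := ModData aU) 0 x + Lop (W := ModData aV) 0 x) h);
  pair_low : forall h, exists N : int, forall n : int, n <= N ->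
    geig (fun x => Lop (W := ModData aU) 0 x + Lop (W := ModData aV) 0 x)
      (h + n%:~R) `<=` [set 0];
  pair_cofin : exists (n : nat) (e : 'I_n -> X), forall x, exists a c d,
    [/\ C1_space (W := ModData aU) c, C1_space (W := ModData aV) d
      & x = \sum_(i < n) a i *: e i + (c + d)] }.

Lemma C1_pair_sym U V X aU aV : @C1_pair U V X aU aV -> C1_pair aV aU.
Proof.
case=> vU vV gU gV wU wV comm dec fin low [n [e he]].
have swap : (fun x => Lop (W := ModData aV) 0 x + Lop (W := ModData aU) 0 x) =
    (fun x => Lop (W := ModData aU) 0 x + Lop (W := ModData aV) 0 x).
  by apply/funext => x; rewrite addrC.
split=> //; rewrite ?swap //; exists n, e => x.
by have [a [c [d [Cc Cd ->]]]] := he x; exists a, d, c; split=> //; rewrite [c + d]addrC.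
Qed.

Section OneSide.
Variables (U V : voa_data K) (X : lmodType K).
Variables (aU : U -> int -> X -> X) (aV : V -> int -> X -> X).
Hypothesis pr : C1_pair aU aV.

Let XU : mod_data U := ModData aU.
Let XV : mod_data V := ModData aV.
Let LU : X -> X := @Lop K U XU 0.
Let LV : X -> X := @Lop K V XV 0.
Let L : X -> X := fun x => LU x + LV x.

Lemma pair_linU u n : linear (aU u n).
Proof. exact: (act_linear (pair_weakU pr)). Qed.

Lemma pair_linV v n : linear (aV v n).
Proof. exact: (act_linear (pair_weakV pr)). Qed.

Let LUlin : linear LU. Proof. exact: pair_linU. Qed.
Let LVlin : linear LV. Proof. exact: pair_linV. Qed.

Let Llin : linear L.
Proof. by move=> a x y; rewrite /L LUlin LVlin scalerDr addrACA. Qed.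

Let LU_aV v n x : LU (aV v n x) = aV v n (LU x).
Proof. exact: pair_comm pr _ _ _ _ _. Qed.

Let LV_aU u n x : LV (aU u n x) = aU u n (LV x).
Proof. exact/esym/(pair_comm pr). Qed.

Let LULV x : LU (LV x) = LV (LU x). Proof. exact: LU_aV. Qed.

Let LU_C1 (u : U) (k : int) x : weight_space k u ->
  LU (aU u (-1) x) = aU u (-1) (LU x) + k%:~R *: aU u (-1) x.
Proof.
move=> ku; have := Lop0_act (pair_weakU pr) (pair_voaU pr) (-1) x ku.
by rewrite opprK addrK.
Qed.

Let LV_C1 (v : V) (k : int) x : weight_space k v ->
  LV (aV v (-1) x) = aV v (-1) (LV x) + k%:~R *: aV v (-1) x.
Proof.
move=> kv; have := Lop0_act (pair_weakV pr) (pair_voaV pr) (-1) x kv.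
by rewrite opprK addrK.
Qed.

Let L_aU (u : U) (k : int) x : weight_space k u ->
  L (aU u (-1) x) = aU u (-1) (L x) + k%:~R *: aU u (-1) x.
Proof.
by move=> ku; rewrite /L (LU_C1 _ ku) LV_aU (linD (pair_linU _ _)) addrAC.
Qed.

Let L_aV (v : V) (k : int) x : weight_space k v ->
  L (aV v (-1) x) = aV v (-1) (L x) + k%:~R *: aV v (-1) x.
Proof.
by move=> kv; rewrite /L (LV_C1 _ kv) LU_aV (linD (pair_linV _ _)) addrA.
Qed.

(** The generalized eigenspaces of [L] are finite-dimensional and, since [LU] commutes with [LV],
    stable under [LU]. *)
Lemma pair_decU x : decomposable LU x.
Proof.
apply: (subset_geigs Llin (pair_dec pr)); first exact: subspace_decomposable.
move=> h y hy; apply: (decomposable_bounded LUlin closedK) (pair_fin pr h) hy.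
split=> [|z]; first exact: subspace_geig.
by apply: geig_comm => // t; rewrite /L (linD LUlin) LULV.
Qed.

(** Induction on the total weight inside a class h + Z, where weights are bounded below: u_(-1) and
    v_(-1) raise the weight by k > 0. Closure under [L] stands in for homogeneous generators, since
    it puts all weight components of the vectors of [T] into [Z]. *)
Lemma pair_generators : exists T : seq X, forall Z : set X, subspace Z ->
  (forall t, t \in T -> Z t) -> (forall x, Z x -> Z (L x)) ->
  (forall u (k : int) x, weight_space k u -> 0 < k -> Z x -> Z (aU u (-1) x)) ->
  (forall v (k : int) x, weight_space k v -> 0 < k -> Z x -> Z (aV v (-1) x)) ->
  forall x, Z x.
Proof.
have [n [e he]] := pair_cofin pr.
exists (codom e) => Z sZ ZT ZL ZU ZV.
have dec := pair_dec pr.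
have Ze i : Z (e i) by apply: ZT; exact: codom_f.
apply: (subset_geigs Llin dec) => // h.
have [N hN] := pair_low pr h.
(* The weights [h + m] with [m <= N] do not occur, and [m = 0], the weight of [x], is reached within
   [absz N] steps from [N]. *)
suff key (j : nat) (m : int) : m <= N + j%:Z -> geig L (h + m%:~R) `<=` Z.
  by move=> x hx; apply: (key (absz N) 0); [lia | rewrite addr0].
elim: j m => [|j IH] m mN x hx.
  by move: mN; rewrite addr0 => /hN/(_ _ hx) ->; exact: sZ.1.
have plin := proj_linear Llin dec (h + m%:~R).
have move_aU u (k : int) y : weight_space k u ->
    proj L (h + m%:~R) (aU u (-1) y) = aU u (-1) (proj L (h + (m - k)%:~R) y).
  move=> ku; rewrite -(proj_move Llin dec _ _ (pair_linU u (-1)) (fun y => L_aU y ku)).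
  by rewrite -addrA -intrD subrK.
have move_aV v (k : int) y : weight_space k v ->
    proj L (h + m%:~R) (aV v (-1) y) = aV v (-1) (proj L (h + (m - k)%:~R) y).
  move=> kv; rewrite -(proj_move Llin dec _ _ (pair_linV v (-1)) (fun y => L_aV y kv)).
  by rewrite -addrA -intrD subrK.
have ZC : subspace (proj L (h + m%:~R) @^-1` Z) by exact: subspace_preimage.
have [a [c [d [Cc Cd ex]]]] := he x.
rewrite -(proj_id Llin hx) ex !(linD plin).
apply: (subspaceD sZ); last apply: (subspaceD sZ).
- apply: (proj_stable Llin dec) => //; apply: subspace_sum => // i _ _.
  exact: subspaceZ.
- apply: (span_min ZC _ Cc) => _ [u [k [y [ku k0 ->]]]].
  rewrite /preimage /= (move_aU _ _ _ ku); apply: (ZU _ k) => //.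
  by apply: (IH (m - k)); [lia | exact: proj_geig].
- apply: (span_min ZC _ Cd) => _ [v [k [y [kv k0 ->]]]].
  rewrite /preimage /= (move_aV _ _ _ kv); apply: (ZV _ k) => //.
  by apply: (IH (m - k)); [lia | exact: proj_geig].
Qed.

Hypothesis decV : forall x, decomposable LV x.

Lemma C1_comm (S : X -> X) : linear S -> (forall u n x, S (aU u n x) = aU u n (S x)) ->
  forall x, C1_space (W := XU) x -> C1_space (W := XU) (S x).
Proof.
move=> Slin SU; apply: span_min.
  by apply: (subspace_preimage Slin); exact: subspace_span.
move=> _ [u [k [y [ku k0 ->]]]]; rewrite /preimage /= SU.
by apply: sub_span; exists u, k, (S y).
Qed.

(* Modulo [C1_space XU], every vector has one of finitely many [LU]-weights,
   because C_1-generation over V does not change the [LU]-weight. *)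
Lemma pair_C1_supp : exists s : seq K, forall x,
  sumset (C1_space (W := XU)) (geig_supp LU s) x.
Proof.
have [T hT] := pair_generators.
have /boolp.choice[f fE] : forall x, exists s, geig_supp LU s x.
  exact: (geig_supp_exists LUlin pair_decU).
exists (flatten [seq f t | t <- T]); set s := flatten _.
have sC : subspace (C1_space (W := XU)) by exact: subspace_span.
have sG : subspace (geig_supp LU s) by exact: (subspace_geig_supp LUlin pair_decU).
have sZ := subspace_sumset sC sG.
have CL : forall x, C1_space (W := XU) x -> C1_space (W := XU) (L x).
  apply: span_min; first exact: (subspace_preimage Llin).
  move=> _ [u [k [y [ku k0 ->]]]]; rewrite /preimage /= (L_aU _ ku).
  apply: (subspaceD sC); last apply: (subspaceZ _ sC).
    by apply: sub_span; exists u, k, (L y).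
  by apply: sub_span; exists u, k, y.
apply: hT => //.
- move=> t tT; apply: (sumsetr sC).
  apply: (geig_supp_mono _ (fE t)) => h hf; apply/flattenP; exists (f t) => //.
  exact: map_f.
- move=> _ [c [y [Cc Gy ->]]]; exists (L c), (L y); split.
  + exact: CL.
  + by apply: (geig_supp_comm LUlin pair_decU) => // z; rewrite /L (linD LUlin) LULV.
  + exact: linD.
- move=> u k x ku k0 _; apply: (sumsetl sG).
  by apply: sub_span; exists u, k, x.
- move=> v k _ kv k0 [c [y [Cc Gy ->]]]; exists (aV v (-1) c), (aV v (-1) y).
  have vlin := pair_linV v (-1); split.
  + by apply: C1_comm => // u n z; rewrite (pair_comm pr).
  + by apply: (geig_supp_comm LUlin pair_decU) => // z; rewrite LU_aV.
  + exact: linD.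
Qed.

Let geig_L h g x : geig LU h x -> geig LV g x -> geig L (h + g) x.
Proof. exact: (geig_add LUlin LVlin LULV). Qed.

Lemma geig_supp_act s (u : U) n (x : XU) :
  geig_supp LV s x -> geig_supp LV s (act u n x).
Proof.
move=> sx; apply: (geig_supp_comm LVlin decV (pair_linU u n) _ sx) => y; exact: LV_aU.
Qed.

Definition supp_sub s : submodule XU :=
  @build_sub K U XU (geig_supp LV s) (subspace_geig_supp LVlin decV s)
    (@geig_supp_act s).

Let proj_supp_act s (u : U) n x : proj_supp LV s (aU u n x) = aU u n (proj_supp LV s x).
Proof.
rewrite /proj_supp (lin_sum (pair_linU u n)); apply: eq_bigr => h _.
by apply: (proj_comm LVlin decV); [exact: pair_linU | exact: LV_aU].
Qed.

(** An L^U(0)-weight h and an L^V(0)-weight g determine the total weight h + g, whose space is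
    finite-dimensional, and only finitely many pairs occur. *)
Lemma bounded_geig_supp s r : bounded_dim (geig_supp LV s `&` geig_supp LU r).
Proof.
have bd g : bounded_dim [set z | exists f : K -> X,
    (forall h, h \in undup r -> geig L (h + g) (f h)) /\ z = \sum_(h <- undup r) f h].
  exact: (bounded_dim_big_sum (B := fun h => geig L (h + g)) (fun h _ => pair_fin pr (h + g))).
have := bounded_dim_big_sum (s := undup s) (fun g _ => bd g).
apply: bounded_dim_mono => x [sx rx].
exists (fun g => proj LV g x); split; last by rewrite -/(proj_supp LV s x) (proj_supp_id LVlin decV).
move=> g _; exists (fun h => proj LU h (proj LV g x)); split.
  move=> h _; apply: geig_L; first exact: (proj_geig LUlin pair_decU).
  apply: (proj_stable LUlin pair_decU); last exact: (proj_geig LVlin decV).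
  split=> [|y]; first exact: subspace_geig.
  by apply: geig_comm => // z; rewrite LULV.
rewrite -/(proj_supp LU r _) (proj_supp_id LUlin pair_decU) //.
apply: (@proj_stable _ _ _ LVlin decV (geig_supp LU r)) => //.
split; first exact: (subspace_geig_supp LUlin pair_decU).
by move=> y; apply: (geig_supp_comm LUlin pair_decU).
Qed.

(** [proj_supp LV s] commutes with U, so it carries C_1^U(X) into C_1 of this submodule. Applied to
    [pair_C1_supp], it leaves only the finite-dimensional space of vectors with L^V(0)-weights in
    [s] and L^U(0)-weights in [r]. *)
Lemma C1_category_supp s : C1_category (sub_mod (supp_sub s)).
Proof.
have vlin := @val_linear K U XU (supp_sub s).
have vinj := @val_inj_sub K U XU (supp_sub s).
have sLUh h : stable LV (geig LU h).
  split=> [|y]; first exact: subspace_geig.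
  by apply: geig_comm => // z; rewrite LULV.
split.
  apply: (gr_module_inj vlin vinj) => //; first exact: (pair_weakU pr).
  - by move=> w; exact: pair_decU.
  - move=> h; have := bounded_geig_supp s [:: h]; apply: bounded_dim_mono.
    move=> x [hx [w _ ew]]; rewrite -ew in hx *; split; first exact: (valP_sub w).
    exact: (geig_geig_supp LUlin (mem_head _ _) hx).
  move=> h.
  (* A common bound for the finitely many L^V(0)-weights g in [s]: a vector with weights h + n and g
     has total weight h + g + n. *)
  have [N hN] : exists N : int, forall g, g \in s -> forall n : int, n <= N ->
      geig L (h + g + n%:~R) `<=` [set 0].
    elim: (s) => [|g r [N hN]]; first by exists 0.
    have [M hM] := pair_low pr (h + g); exists (Num.min N M) => g'.
    rewrite inE => /orP[/eqP->|gr] n; rewrite le_min => /andP[nN nM]; first exact: hM.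
    exact: hN gr _ nN.
  exists N => n w nN hw; apply: vinj => /=.
  rewrite -(proj_supp_id LVlin decV (valP_sub w)); apply: big1_seq => g /andP[_ gs].
  rewrite mem_undup in gs; apply: (hN g gs n nN); rewrite addrAC.
  apply: geig_L; last exact: (proj_geig LVlin decV).
  exact: (proj_stable LVlin decV).
have [r hr] := pair_C1_supp.
have [n [e [Ge he]]] : finite_dimensional (geig_supp LV s `&` geig_supp LU r).
  apply: bounded_dim_finite (bounded_geig_supp s r); apply: subspaceI.
    exact: (subspace_geig_supp LVlin decV).
  exact: (subspace_geig_supp LUlin pair_decU).
exists n, (fun i => in_sub (S := supp_sub s) (Ge i).1) => w.
have qlin := proj_supp_linear LVlin decV s.
have [c [y [Cc Gy ew]]] := hr (val w).
have [a ea] : exists a : 'I_n -> K, proj_supp LV s y = \sum_(i < n) a i *: e i.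
  apply: he; split; first exact: (proj_supp_mem LVlin decV).
  rewrite /proj_supp; apply: subspace_sum => [|g _ _].
    exact: (subspace_geig_supp LUlin pair_decU).
  apply: (@proj_stable _ _ _ LVlin decV (geig_supp LU r)) => //.
  split; first exact: (subspace_geig_supp LUlin pair_decU).
  by move=> z; apply: (geig_supp_comm LUlin pair_decU).
exists a.
pose C : set X := [set val z | z in C1_space (W := sub_mod (supp_sub s))].
have : C1_space (W := XU) `<=` proj_supp LV s @^-1` C.
  apply: span_min.
    apply: (subspace_preimage qlin); apply: (subspace_image vlin); exact: subspace_span.
  move=> _ [u [k [z [ku k0 ->]]]]; rewrite /preimage /= proj_supp_act.
  exists (act u (-1) (in_sub (S := supp_sub s) (proj_supp_mem LVlin decV (s := s) z))) => //.
  by apply: sub_span; exists u, k; eexists; split.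
move=> /(_ c Cc)[z Cz ez]; suff -> : w - \sum_(i < n) a i *: in_sub (S := supp_sub s) (Ge i).1 = z by [].
apply: vinj; rewrite (linB vlin) (lin_sum vlin) ez.
rewrite -(proj_supp_id LVlin decV (valP_sub w)) ew (linD qlin) ea.
rewrite (eq_bigr (fun i => a i *: e i)) ?addrK //.
Qed.

Lemma C1_category_pair_generated (x : XU) :
  closed_under_submodules (C1_category (V := U)) -> C1_category (sub_mod (generated x)).
Proof.
move=> closed; have [s sx] := geig_supp_exists LVlin decV x.
exact: (C1_category_generated closed (C1_category_supp s)).
Qed.

End OneSide.
End CommutingPairs.

(** * A bound for the length *)

Section PairRank.
Variables (K : numFieldType).
Hypothesis closedK : forall p : {poly K}, size p != 1%N -> exists c, root p c.
Variables (U V : voa_data K) (X : lmodType K).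
Variables (aU : U -> int -> X -> X) (aV : V -> int -> X -> X).
Hypothesis pr : C1_pair aU aV.
Hypotheses (subV : closed_under_submodules (C1_category (V := V)))
  (lengthU : all_finite_length (C1_category (V := U)))
  (lengthV : all_finite_length (C1_category (V := V))).

Let XU : mod_data U := ModData aU.
Let XV : mod_data V := ModData aV.
Let decU := pair_decU closedK pr.
Let decV := pair_decU closedK (C1_pair_sym pr).

Lemma pair_generators_mode : exists T : seq X, forall Z : set X, subspace Z ->
  (forall t, t \in T -> Z t) -> (forall u n x, Z x -> Z (aU u n x)) ->
  (forall v n x, Z x -> Z (aV v n x)) -> forall x, Z x.
Proof.
have [T hT] := pair_generators pr; exists T => Z sZ ZT ZU ZV.
apply: hT => //.
- by move=> x Zx; apply: subspaceD => //; [exact: ZU | exact: ZV].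
- by move=> u k x _ _; exact: ZU.
- by move=> v k x _ _; exact: ZV.
Qed.

(* X is spanned by the images of the V-modules generated by finitely many
   vectors under V-endomorphisms of X, so finitely many V-weights detect
   inclusions of submodules. *)
Lemma pair_weights : exists H : seq K, forall P Q : submodule XV, P `<=` Q ->
  (forall h x, h \in H -> geig (@Lop K V XV 0) h x -> sub_set Q x -> sub_set P x) ->
  Q `<=` P.
Proof.
have wV := pair_weakV pr.
have [T hT] := pair_generators_mode.
have CV (t : XV) : C1_category (sub_mod (generated t)).
  exact: (C1_category_pair_generated closedK (C1_pair_sym pr) decU t subV).
have /boolp.choice[H HE] : forall t : XV, exists H : seq K,
    forall (a : sub_mod (generated t) -> XV) (P Q E : submodule XV),
    module_map a -> P `<=` Q ->
    (forall h x, h \in H -> geig (@Lop K V XV 0) h x -> sub_set Q x -> sub_set P x) ->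
    Q `&` E `<=` P -> Q `&` sumset (sub_set E) (range a) `<=` P.
  move=> t; have [/gr_moduleP[wN decN _ _] _] := CV t.
  have [H hH] := finite_length_weights wN (lengthV (CV t)) decN.
  by exists H => a P Q E am; apply: hH.
exists (flatten [seq H t | t <- T]) => P Q PQ PQh.
pose good (E : submodule XV) := Q `&` E `<=` P.
(* Quantifying over [E'] makes the property additive: [E1] and [E2] can be adjoined one after the
   other. *)
pose extends (E : submodule XV) := forall E', good E' -> good (add_sub wV E' E).
(* All V-endomorphisms [b] are treated at once, so that closure under u_n is immediate:
   [b \o aU u n] is again a V-endomorphism. *)
suff all_in : forall x, forall b : XV -> XV, module_map b ->
    exists2 E, extends E & sub_set E (b x).
  move=> x Qx; have [|E extE Ex] := all_in x id; first by split.
  have /extE : good (null_sub wV) by move=> _ [_ ->]; exact: sub0.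
  apply; split=> //; exact: (sumsetr (subspace_sub (null_sub wV))).
apply: hT.
- split=> [b bm|a x y hx hy b bm].
    exists (null_sub wV); last exact: lin0 bm.1.
    move=> E' gE x [Qx [y [_ [Ey -> ex]]]].
    by apply: gE; rewrite ex addr0 in Qx *.
  have [E1 ext1 E1x] := hx b bm; have [E2 ext2 E2y] := hy b bm.
  exists (add_sub wV E1 E2).
    move=> E' /ext1/ext2 gE z [Qz [e [_ [Ee [e1 [e2 [Ee1 Ee2 ->]]] ez]]]].
    apply: gE; split=> //; exists (e + e1), e2; split=> //; last by rewrite ez addrA.
    by exists e, e1.
  rewrite bm.1; exists (a *: b x), (b y); split=> //.
  exact: (subspaceZ _ (subspace_sub E1)).
- move=> t tT b bm.
  have am : module_map (fun y : sub_mod (generated (t : XV)) => b (val y)).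
    split=> [a x y|v n x]; first exact: bm.1.
    exact: bm.2.
  exists (image_sub am (full_sub _)).
    move=> E' gE; apply: (HE t) => // h x hh; apply: PQh.
    by apply/flattenP; exists (H t) => //; exact: map_f.
  by exists (in_sub (@generated_mem K V XV t)).
- move=> u n x hx b bm; apply: (hx (b \o aU u n)); split=> [a y z|v m y] /=.
    by rewrite (pair_linU pr) bm.1.
  apply: etrans (bm.2 v m (aU u n y)); congr b; exact: pair_comm pr _ _ _ _ _.
- move=> v n x hx b bm; have [E extE Ex] := hx b bm; exists E => //.
  have -> : b (aV v n x) = act v n (b x) by exact: bm.2.
  exact: sub_act.
Qed.

(** Only the intersection of a submodule with [G] is ranked, by a composition series of [G] over U.
    [S] and [T] are asked to be V-stable because the weights in [H] detect inclusions of
    V-submodules. *)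
Lemma pair_rank : exists (n : nat) (r : submodule XU -> nat),
  (forall S, (r S <= n)%N) /\
  forall S T : submodule XU, (forall v n x, sub_set S x -> sub_set S (aV v n x)) ->
    (forall v n x, sub_set T x -> sub_set T (aV v n x)) ->
    S `<=` T -> (r S <= r T)%N /\ (r S = r T -> T `<=` S).
Proof.
have [H hH] := pair_weights.
pose G := supp_sub pr decV H.
have CG : C1_category (sub_mod G) by exact: C1_category_supp.
have wG : is_weak_module (sub_mod G) by case: CG => -[[]].
have [n [r [rn mono]]] := rank_of_finite_length wG (lengthU CG).
exists n, (fun S => r (pullback G S)); split=> // S T Sv Tv ST.
have [|le eqr] := mono (pullback G S) (pullback G T); first by move=> x; exact: ST.
split=> // /eqr sub.
pose S' : submodule XV := build_sub (W := XV) (subspace_sub S) Sv.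
pose T' : submodule XV := build_sub (W := XV) (subspace_sub T) Tv.
apply: (hH S' T') => // h x hH' hx Tx.
have Gx : sub_set G x by exact: (geig_geig_supp (Lop_linear (pair_weakV pr) 0) hH' hx).
exact: (sub (in_sub Gx)).
Qed.

End PairRank.

(** * Modules for the tensor product *)

Section TensorProducts.
Variables (K : numFieldType) (U V : voa_data K).
Hypotheses (hU : is_voa U) (hV : is_voa V).
Let wU : is_weak_module (adjoint U) := adjoint_weak hU.
Let wV : is_weak_module (adjoint V) := adjoint_weak hV.

Lemma tens_linear_l (v : V) : linear (fun u : U => tens u v).
Proof. by move=> a x y; rewrite (tens_bilinear U V).1. Qed.

Lemma tens_linear_r (u : U) : linear (fun v : V => tens u v).
Proof. by move=> a x y; rewrite (tens_bilinear U V).2. Qed.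

Lemma tens_nprod_fin (u u' : U) (v v' : V) (n : int) : exists A : seq int,
  forall j, j \notin A -> tens (nprod u j u') (nprod v (n - 1 - j) v') = 0.
Proof.
have [_ tU _ _] := wU; have [_ tV _ _] := wV.
have [M /= xM] := tU u u'; have [N /= yN] := tV v v'.
(* A nonzero term needs j < M and n - 1 - j < N, that is n - N <= j < M. *)
exists [seq n - N + i%:Z | i <- iota 0 (absz (M - (n - N))%R)] => j /mapP jA.
have [Mj|jM] := leP M j; first by rewrite xM // (lin0 (tens_linear_l _)).
have [Nj|jN] := leP N (n - 1 - j); first by rewrite yN // (lin0 (tens_linear_r _)).
by case: jA; exists (absz (j - (n - N))%R); [rewrite mem_iota|]; lia.
Qed.

Lemma tensor_nprod_bilinear n : bilinear_map (fun p q : tensor U V => tensor_nprod p n q).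
Proof.
have lU w j : linear (fun u : U => nprod u j w) := act_linear_l wU j w.
have lU' u j : linear (nprod u j : U -> U) := act_linear wU u j.
have lV w j : linear (fun v : V => nprod v j w) := act_linear_l wV j w.
have lV' v j : linear (nprod v j : V -> V) := act_linear wV v j.
have inner u v : bilinear_map (fun u' v' =>
    \sum_(j \in [set: int]) tens (nprod u j u' : U) (nprod v (n - 1 - j) v' : V)).
  split=> [a x x' y|a x y y']; apply: fsumP; try exact: tens_nprod_fin.
    by move=> j; rewrite lU' tens_linear_l.
  by move=> j; rewrite lV' tens_linear_r.
have outer q : bilinear_map (fun u v => tensor_lift (fun u' v' =>
    \sum_(j \in [set: int]) tens (nprod u j u' : U) (nprod v (n - 1 - j) v' : V)) q).
  split=> [a x x' y|a x y y']; rewrite /tensor_lift scaler_sumr -big_split;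
    apply: eq_bigr => z _; apply: fsumP; try exact: tens_nprod_fin.
    by move=> j; rewrite lU tens_linear_l.
  by move=> j; rewrite lV tens_linear_r.
split=> [a p p' q|a p q q']; first exact: (tensor_lift_linear (outer q)).
rewrite /tensor_nprod /tensor_lift scaler_sumr -big_split; apply: eq_bigr => z _.
exact: (tensor_lift_linear (inner z.1 z.2)).
Qed.

Lemma nprod_tens_l u n u' v' :
  tensor_nprod (tens u (vacuum V)) n (tens u' v') = tens (nprod u n u') v' :> tensor U V.
Proof.
rewrite tensor_nprod_tens // (@fsum_supp _ _ [:: n]) // => [|j].
  rewrite big_seq1 [nprod (vacuum V) _ v'](act_vacuum wV).
  by have -> : n - 1 - n == -1 by apply/eqP; lia.
rewrite inE => jn; rewrite [nprod (vacuum V) _ v'](act_vacuum wV).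
have /negPf-> : n - 1 - j != -1 by apply: contra jn => /eqP ?; apply/eqP; lia.
exact: lin0 (tens_linear_r _).
Qed.

Lemma nprod_tens_r v n u' v' :
  tensor_nprod (tens (vacuum U) v) n (tens u' v') = tens u' (nprod v n v') :> tensor U V.
Proof.
rewrite tensor_nprod_tens // (@fsum_supp _ _ [:: -1]) // => [|j].
  rewrite big_seq1 [nprod (vacuum U) _ u'](act_vacuum wU).
  by congr (tens _ (nprod _ _ _)); lia.
rewrite inE => jn; rewrite [nprod (vacuum U) _ u'](act_vacuum wU) (negPf jn).
exact: lin0 (tens_linear_l _).
Qed.

Let T : tensor U V -> tensor U V := @Lop K (tensor_voa U V) (adjoint (tensor_voa U V)) 0.

Let Tlin : linear T.
Proof. by move=> a x y; exact: (tensor_nprod_bilinear _).2. Qed.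

Lemma Lop0_tens (a b : int) u v : weight_space a u -> weight_space b v ->
  T (tens u v) = (a + b)%:~R *: tens u v.
Proof.
move=> ua vb; rewrite /T /Lop /= (bilinear_mapDl _ _ _ (tensor_nprod_bilinear _)).
rewrite nprod_tens_l nprod_tens_r.
rewrite (ua : nprod (conformal U) (0 + 1) u = _) (vb : nprod (conformal V) (0 + 1) v = _).
by rewrite (linZ (tens_linear_l _)) (linZ (tens_linear_r _)) -scalerDl intrD.
Qed.

Hypotheses (gU : N_graded U) (gV : N_graded V).

Lemma tensor_weight_induction (P : set (tensor U V)) : subspace P ->
  (forall (a b : int) u v, 0 <= a -> 0 <= b -> weight_space a u ->
     weight_space b v -> P (tens u v)) -> forall p, P p.
Proof.
move=> sP hP p; rewrite [p]tensor_sum; apply: subspace_sum => // z _ _.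
apply: (weight_induction hU gU (P := fun u => P (tens u z.2))).
  exact: (subspace_preimage (tens_linear_l _) sP).
move=> a a0 u ua; apply: (weight_induction hV gV (P := fun v => P (tens u v))).
  exact: (subspace_preimage (tens_linear_r _) sP).
by move=> b b0 v vb; exact: hP ua vb.
Qed.

(** A pure tensor of homogeneous vectors is an eigenvector of [T], so the projection to weight [n]
    keeps or kills it. Applied to an expression of [p] by such tensors, it removes the terms with
    [a + b != n]. *)
Lemma tensor_weight_space (n : int) (p : tensor_voa U V) : weight_space n p ->
  span [set q : tensor U V | exists (a b : int) u v, [/\ 0 <= a, 0 <= b,
    weight_space a u /\ weight_space b v, a + b = n & q = tens u v]] p.
Proof.
have geigT (q : tensor U V) (k : int) : T q = k%:~R *: q -> geig T k%:~R q.
  by move=> e; exists 1%N; rewrite /= /shift e subrr.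
have dec q : decomposable T q.
  apply: (tensor_weight_induction (subspace_decomposable Tlin)) => a b u v _ _ ua vb.
  exact: (geig_decomposable Tlin (geigT _ _ (Lop0_tens ua vb))).
move=> pn; set A := [set q | _].
suff key q : span A (proj T n%:~R q).
  by rewrite -[p](proj_id Tlin (geigT p n pn)); exact: key.
apply: (tensor_weight_induction (P := proj T n%:~R @^-1` span A)).
  by apply: subspace_preimage (subspace_span _); exact: proj_linear.
move=> a b u v a0 b0 ua vb; rewrite /preimage /=.
have abT := geigT _ _ (Lop0_tens ua vb).
have [abn|abn] := eqVneq (a + b) n.
  by rewrite (proj_id Tlin) ?abn -?abn //; apply: sub_span; exists a, b, u, v.
rewrite (proj_neq Tlin _ abT); first exact: (subspace_span _).1.
by rewrite eqr_int eq_sym.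
Qed.

Section TensorModules.
Variable X : mod_data (tensor_voa U V).
Hypothesis wX : is_weak_module X.
Let aU (u : U) : int -> X -> X := act (tens u (vacuum V) : tensor_voa U V).
Let aV (v : V) : int -> X -> X := act (tens (vacuum U) v : tensor_voa U V).

Lemma nprod_creation u v : tensor_nprod (tens u (vacuum V)) (-1) (tens (vacuum U) v) = tens u v.
Proof. by rewrite nprod_tens_l; have [[_ /(_ u)[-> _]] _ _ _ _] := hU. Qed.

Lemma restrict_left_weak : is_weak_module (restrict_left X).
Proof.
have [_ tr vac jac] := wX; split.
- move=> n; split=> [a u u' x|a u x y] /=.
    by rewrite tens_linear_l (act_linear_l wX).
  exact: (act_linear wX).
- by move=> u x; exact: tr.
- by move=> n x; exact: vac.
- move=> u v x l m n; rewrite -[RHS]jac.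
  by apply: eq_fsbigr => i _; rewrite /= nprod_tens_l.
Qed.

Lemma restrict_right_weak : is_weak_module (restrict_right X).
Proof.
have [_ tr vac jac] := wX; split.
- move=> n; split=> [a u u' x|a u x y] /=.
    by rewrite tens_linear_r (act_linear_l wX).
  exact: (act_linear wX).
- by move=> u x; exact: tr.
- by move=> n x; exact: vac.
- move=> u v x l m n; rewrite -[RHS]jac.
  by apply: eq_fsbigr => i _; rewrite /= nprod_tens_r.
Qed.

(** The commutator formula involves only (u (x) 1)_i (1 (x) v) = u_i 1 (x) v with i >= 0, and u_i 1
    = 0 there. *)
Lemma restrict_comm u v m n x : aU u m (aV v n x) = aV v n (aU u m x).
Proof.
apply/eqP; rewrite -subr_eq0 (commutator wX) (@fsum_supp _ _ [::]) ?big_nil // => i _.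
have [[_ /(_ u)[_ cr]] _ _ _ _] := hU.
rewrite /= nprod_tens_l cr // (lin0 (tens_linear_l _)).
by rewrite (lin0 (act_linear_l wX _ _)) scaler0.
Qed.

(** u (x) v is (u (x) 1)_(-1) (1 (x) v), and at [l = -1] the signs cancel those of the binomials in
    the iterate formula. *)
Lemma act_tens u v n x : act (tens u v : tensor_voa U V) n x =
  \sum_(i \in [set: nat]) (aU u (-1 - i%:Z) (aV v (n + i%:Z) x)
    + aV v (n + -1 - i%:Z) (aU u i%:Z x)).
Proof.
rewrite -nprod_creation (iterate wX); apply: eq_fsbigr => i _.
by rewrite sign_binzN1 scale1r -[(-1) ^ (-1)]/((-1)^-1) invrN1 scaleN1r opprK.
Qed.

Lemma restrict_closed (P : set X) : subspace P ->
  (forall u n x, P x -> P (aU u n x)) -> (forall v n x, P x -> P (aV v n x)) ->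
  forall (p : tensor_voa U V) n x, P x -> P (act p n x).
Proof.
move=> sP PU PV p n x Px; rewrite [p](@tensor_sum _ U V).
rewrite (lin_sum (act_linear_l wX n x)); apply: subspace_sum => // z _ _.
rewrite act_tens; apply: subspace_fsum => // i.
by apply: subspaceD => //; [apply/PU/PV | apply/PV/PU].
Qed.

Lemma Lop0_restrict (x : X) :
  Lop 0 x = Lop (W := restrict_left X) 0 x + Lop (W := restrict_right X) 0 x.
Proof. exact: (linD (act_linear_l wX _ _)). Qed.

(** At [n = -1] the terms of [act_tens] are u_(-1-i) v_(-1+i) and v_(-2-i) u_i. The latter lie in
    C_1^V. The former lie in C_1^U unless i = 0 and u has weight 0; then v has positive weight, and
    u_(-1) v_(-1) = v_(-1) u_(-1) lies in C_1^V. *)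
Lemma C1_restrict : C1_space (W := X) `<=`
  sumset (C1_space (W := restrict_left X)) (C1_space (W := restrict_right X)).
Proof.
set CU := C1_space (W := restrict_left X); set CV := C1_space (W := restrict_right X).
have sU : subspace CU by exact: subspace_span.
have sV : subspace CV by exact: subspace_span.
have sC := subspace_sumset sU sV.
apply: span_min => // _ [p [n [x [pn n0 ->]]]].
have sP := subspace_preimage (act_linear_l wX (-1) x) sC.
apply: (span_min sP _ (tensor_weight_space pn)).
move=> _ [a [b [u [v [a0 b0 [ua vb] abn ->]]]]]; rewrite /preimage /= act_tens.
apply: subspace_fsum => // i; apply: subspaceD => //; last first.
  apply: (sumsetr sU).
  rewrite (_ : -1 + -1 - i%:Z = -1 - i.+1%:Z); last by lia.
  by apply: (@C1_mode _ _ hV gV (restrict_right X) b v i.+1 _ restrict_right_weak vb); rewrite orbT.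
case: (boolP ((0 < a) || (0 < i)%N)) => [ai|].
  by apply: (sumsetl sV); exact: (@C1_mode _ _ hU gU (restrict_left X) a u i _ restrict_left_weak ua).
rewrite negb_or => /andP[na ni].
have -> : i = 0%N by lia.
apply: (sumsetr sU); rewrite restrict_comm.
have -> : -1 + 0%N%:Z = -1 - 0%N%:Z :> int by [].
apply: (@C1_mode _ _ hV gV (restrict_right X) b v 0 _ restrict_right_weak vb); apply/orP; left; lia.
Qed.

Lemma C1_restrict_left : C1_space (W := restrict_left X) `<=` C1_space (W := X).
Proof.
apply: span_mono => _ [u [k [x [uk k0 ->]]]].
exists (tens u (vacuum V) : tensor_voa U V), k, x; split=> //.
by apply: etrans (Lop0_tens uk (weight_vacuum hV)) _; rewrite addr0.
Qed.

Lemma C1_restrict_right : C1_space (W := restrict_right X) `<=` C1_space (W := X).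
Proof.
apply: span_mono => _ [v [k [x [vk k0 ->]]]].
exists (tens (vacuum U) v : tensor_voa U V), k, x; split=> //.
by apply: etrans (Lop0_tens (weight_vacuum hU) vk) _; rewrite add0r.
Qed.

End TensorModules.
End TensorProducts.

(** One vector is taken from each [F i.+1] outside [F i]; by simplicity it generates the factor, so
    a submodule containing all of them climbs the series. *)
Lemma finite_length_generators (K : numFieldType) (V : voa_data K) (W : mod_data V) :
  finite_length W -> exists T : seq W, forall S : submodule W,
    (forall t, t \in T -> sub_set S t) -> forall x, sub_set S x.
Proof.
move=> [n [F [F0 Fn hF]]].
have /boolp.choice[f fE] : forall i : nat, exists x : W, (i < n)%N ->
    sub_set (F i.+1) x /\ ~ sub_set (F i) x.
  move=> i; have [iN|] := boolP (i < n)%N; last by exists 0.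
  have [[_ nF] _] := hF _ iN; apply: contrapT => no; apply: nF => x Fx.
  by apply: contrapT => nFx; apply: no; exists x.
exists [seq f i | i <- iota 0 n] => S hS.
suff key i : (i <= n)%N -> F i `<=` S by move=> x; apply: (key n) => //; rewrite Fn.
elim: i => [|i IH] iN; first by rewrite F0 => x ->; exact: sub0.
have [Ff nFf] := fE _ iN; have [[Fii _] simple] := hF _ iN.
have [|||e] := simple (cap_sub S (F i.+1)).
- by move=> x Fx; split; [exact: IH (ltnW iN) x Fx | exact: Fii].
- by move=> x [].
- move=> e; case: nFf; rewrite -e; split=> //.
  by apply: hS; apply/mapP; exists i; rewrite // mem_iota.
- by rewrite -e => x [].
Qed.

(** * The two inclusions between the categories *)

Section Equivalence.
Variables (K : numFieldType).
Hypothesis closedK : forall p : {poly K}, size p != 1%N -> exists c, root p c.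
Variables (U V : voa_data K).
Hypotheses (hU : is_voa U) (hV : is_voa V) (gU : N_graded U) (gV : N_graded V).
Variable X : mod_data (tensor_voa U V).

Let aU (u : U) : int -> X -> X := act (tens u (vacuum V) : tensor_voa U V).
Let aV (v : V) : int -> X -> X := act (tens (vacuum U) v : tensor_voa U V).

Lemma C1_category_pair : C1_category X -> C1_pair aU aV.
Proof.
move=> [/gr_moduleP[wX dec fin low] [n [e he]]].
have E : @Lop K _ X 0 = (fun x => Lop (W := restrict_left X) 0 x + Lop (W := restrict_right X) 0 x).
  by apply/funext => x; exact: Lop0_restrict.
rewrite E in dec fin low; split=> //.
- exact: restrict_left_weak.
- exact: restrict_right_weak.
- exact: restrict_comm.
exists n, e => x; have [a] := he x.
move=> /(C1_restrict hU hV gU gV wX)[c [d [Cc Cd ex]]]; exists a, c, d; split=> //.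
by rewrite -ex addrC subrK.
Qed.

Lemma D_category_of_C1 :
  closed_under_submodules (C1_category (V := U)) ->
  closed_under_submodules (C1_category (V := V)) ->
  all_finite_length (C1_category (V := U)) ->
  all_finite_length (C1_category (V := V)) ->
  C1_category X -> D_category (C1_category (V := U)) (C1_category (V := V)) X.
Proof.
move=> subU subV lengthU lengthV CX.
have pr := C1_category_pair CX; have [grX _] := CX.
have wX : is_weak_module X by case: grX => -[].
have prS := C1_pair_sym pr.
have decU := pair_decU closedK pr; have decV := pair_decU closedK prS.
split=> //.
- have [n [r [rn mono]]] := pair_rank closedK pr subV lengthU lengthV.
  pose rs (S : submodule X) : submodule (ModData aU) :=
    build_sub (W := ModData aU) (subspace_sub S) (fun u n x Sx => sub_act _ n Sx).
  apply: (finite_length_of_rank wX (n := n) (r := r \o rs)) => [S|S T ST]; first exact: rn.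
  have rsV (Q : submodule X) v k x : sub_set (rs Q) x -> sub_set (rs Q) (aV v k x).
    exact: (@sub_act _ _ _ Q).
  exact: mono (rsV S) (rsV T) ST.
- move=> x; exact: (C1_category_pair_generated closedK pr decV x subU).
- move=> x; exact: (C1_category_pair_generated closedK prS decU x subV).
Qed.

(** Words in the modes of U commute with V, so they can be applied to an expression of a vector of V
    t modulo C_1^V without leaving C_1^V. *)
Definition word (l : seq (U * int)) (x : X) : X :=
  foldr (fun p y => aU p.1 p.2 y) x l.

Lemma C1_of_D_category :
  D_category (C1_category (V := U)) (C1_category (V := V)) X -> C1_category X.
Proof.
move=> [grX /finite_length_generators[T hT] CU CV]; split=> //.
have wX : is_weak_module X by case: grX => -[].
have wXU := restrict_left_weak hU hV wX; have wXV := restrict_right_weak hU hV wX.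
have word_linear l : linear (word l).
  by elim: l => [|p l IH] // a x y; rewrite /= IH; exact: (act_linear wXU).
have word_comm l v n x : word l (aV v n x) = aV v n (word l x).
  by elim: l => //= p l ->; exact: restrict_comm.
have sC : subspace (C1_space (W := X)) by exact: subspace_span.
(* C_1 of a submodule lies in C_1 of the ambient module, so finite codimension in the submodule
   yields finitely many representatives in [Y]. *)
have gen_cofin (A : voa_data K) (Y : mod_data A) (y : Y) :
    C1_category (sub_mod (generated y)) -> exists E : seq Y,
      (forall e, e \in E -> generated_set y e) /\ forall z, generated_set y z ->
      exists2 c, C1_space (W := Y) c & exists n (a : 'I_n -> K) (e : 'I_n -> Y),
        (forall i, e i \in E) /\ z = \sum_(i < n) a i *: e i + c.
  move=> [_ [n [e he]]]; exists (codom (fun i => val (e i))); split.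
    by move=> _ /codomP[i ->]; exact: (valP_sub (e i)).
  move=> z yz; have [a Ca] := he (@in_sub K A Y (generated y) z yz).
  have vlin := val_linear (S := generated y).
  exists (val (in_sub (S := generated y) yz - \sum_(i < n) a i *: e i)).
    move: Ca; apply: (span_min (B := [set w | C1_space (W := Y) (val w)])).
      exact: (subspace_preimage vlin (subspace_span _)).
    move=> _ [v [k [w [vk k0 ->]]]]; apply: sub_span.
    by exists v, k, (val w).
  exists n, a, (fun i => val (e i)); split; first by move=> i; exact: codom_f.
  by rewrite (linB vlin) (lin_sum vlin) addrC subrK.
have /boolp.choice[EV hEV] := fun t => gen_cofin _ _ _ (CV t).
have /boolp.choice[EU hEU] := fun t => gen_cofin _ _ _ (CU t).
(* For each generator t there are representatives e of V t modulo C_1^V; [F] collects, for all of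
   these e, the representatives of U e modulo C_1^U. *)
pose F : seq X := flatten [seq EU e | e <- flatten [seq EV t | t <- T]].
pose Z := sumset (span [set` F]) (C1_space (W := X)).
have sF : subspace (span [set` F]) by exact: subspace_span.
have sZ : subspace Z by exact: subspace_sumset.
have wordZ t l y : t \in T -> generated_set (W := restrict_right X) t y -> Z (word l y).
  move=> tT /(hEV t).2[c Cc [n [a [e [eE ->]]]]].
  rewrite (linD (word_linear l)) (lin_sum (word_linear l)); apply: subspaceD => //.
    apply: subspace_sum => // i _ _; rewrite (linZ (word_linear l)).
    apply: subspaceZ => //.
    have : generated_set (W := restrict_left X) (e i) (word l (e i)).
      elim: l => [|p l IH]; first by move=> S.
      exact: (generated_act p.1 p.2 IH).
    move=> /(hEU (e i)).2[d Cd [m [b [f [fE ->]]]]].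
    apply: subspaceD => //; last first.
      by apply: (sumsetr sF); exact: (C1_restrict_left hU hV).
    apply: (sumsetl sC); exists m, b, f; split=> // j.
    apply/flattenP; exists (EU (e i)) => //; apply: map_f.
    by apply/flattenP; exists (EV t) => //; exact: map_f.
  apply: (sumsetr sF).
  move: Cc; apply: (span_min (B := word l @^-1` C1_space (W := X))).
    exact: subspace_preimage.
  move=> _ [v [k [w [vk k0 ->]]]]; apply: (C1_restrict_right hU hV).
  apply: sub_span; exists v, k, (word l w); split=> //; exact: word_comm.
(* U lengthens the word and V passes through it to act on [y], so this span is a U (x) V-submodule;
   it contains [T] by the empty word. *)
pose Y := span [set x | exists t l y,
  [/\ t \in T, generated_set (W := restrict_right X) t y & x = word l y]].
have sY : subspace Y by exact: subspace_span.
have YZ : Y `<=` Z.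
  by apply: span_min => // _ [t [l [y [tT ty ->]]]]; exact: wordZ tT ty.
have YU u n x : Y x -> Y (aU u n x).
  have sP := subspace_preimage (act_linear wXU u n) sY.
  apply: (span_min sP) => _ [t [l [y [tT ty ->]]]]; apply: sub_span.
  by exists t, ((u, n) :: l), y.
have YV v n x : Y x -> Y (aV v n x).
  have sP := subspace_preimage (act_linear wXV v n) sY.
  apply: (span_min sP) => _ [t [l [y [tT ty ->]]]]; apply: sub_span.
  exists t, l, (aV v n y); split=> //; exact: (generated_act v n ty).
pose S : submodule X := build_sub sY (restrict_closed hU hV wX sY YU YV).
have allY : forall x, Y x.
  apply: (hT S) => t tT; apply: sub_span; by exists t, [::], t; split.
exists (size F), (fun i => nth 0 F i) => x.
have [s [c [Fs Cc ->]]] := YZ _ (allY x).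
have [a ->] : exists a : 'I_(size F) -> K, s = \sum_(i < size F) a i *: nth 0 F i.
  apply: (span_min (B := [set s | exists a : 'I_(size F) -> K,
    s = \sum_(i < size F) a i *: nth 0 F i]) _ _ Fs).
    split; first by exists (fun=> 0); rewrite big1 // => i _; rewrite scale0r.
    move=> b y z [a1 ->] [a2 ->]; exists (fun i => b * a1 i + a2 i).
    rewrite scaler_sumr -big_split; apply: eq_bigr => i _.
    by rewrite scalerDl scalerA.
  move=> y /= yF; have iF : (index y F < size F)%N by rewrite index_mem.
  exists (fun i => (i == Ordinal iF)%:R).
  rewrite (bigD1 (Ordinal iF)) //= eqxx scale1r nth_index // big1 ?addr0 // => i /negPf->.
  by rewrite scale0r.
by exists a; rewrite addrAC subrr add0r.
Qed.

End Equivalence.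

Theorem theorem3p7 (R : realType) (U V : voa_data R[i])
  (hU : is_voa U) (hV : is_voa V)
  (gradedU : N_graded U) (gradedV : N_graded V)
  (subU : closed_under_submodules (C1_category (V := U)))
  (subV : closed_under_submodules (C1_category (V := V)))
  (lengthU : all_finite_length (C1_category (V := U)))
  (lengthV : all_finite_length (C1_category (V := V))) :
  forall X : mod_data (tensor_voa U V),
    D_category (C1_category (V := U)) (C1_category (V := V)) X <->
    C1_category X.
Proof.
have closedK (p : {poly R[i]}) : size p != 1%N -> exists c, root p c.
  by move/closed_rootP.
move=> X; split; first exact: C1_of_D_category.
exact: D_category_of_C1.
Qed.
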